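(* Let $\lambda,\Lambda,\varepsilon$ be given with $0<\lambda\le\Lambda$ and $\varepsilon>0$, let $\rho=\Lambda/\lambda$, and let $f_{opt}$ denote the optimal strategy for $\rho$. (a) If $\rho\le 32\cos^5(\pi/7)\approx 18.99761$, the algorithm below computes the exact optimal strategy $f_{opt}$ in $O(1)$ time. (b) Otherwise, the algorithm computes a strategy $f^*_{opt}$ with $CR(f^*_{opt})\le CR(f_{opt})+\varepsilon$; moreover, if the value $n$ computed by the algorithm satisfies $n\ge 7\varepsilon^{-1/3}-4$, it does so in $O(n)=O(\log\rho)$ time, and otherwise its running time equals the time needed by the fastest root-finding algorithm to solve $p_n(x)=\rho$ on $[\alpha_{n+1},\alpha_{n+2})$.
   Context: Model: Real RAM, including $k$-th roots, logarithms, exponentiation and trigonometric functions at unit cost. Search on a line: a target lies at unknown distance $D\in[\lambda,\Lambda]$ on an unknown side of the origin. A search strategy is $f:\mathbb{N}\to\mathbb{R}^+$ ($\mathbb{N}=\{0,1,\dots\}$): in iteration $i$ the searcher walks distance $f(i)$ from the origin, alternating directions, and returns. For $D>0$ let $f^{-1}(D)$ be the smallest $j$ with $f(j)\ge D$, $\phi(f,D)=2\sum_{i=0}^{f^{-1}(D)}f(i)+D$, $CR(f)=\sup_{D\in[\lambda,\Lambda]}\phi(f,D)/D$. An optimal strategy minimizes $CR$ (it may be taken monotone and periodic). Polynomials: $p_0(x)=x$, $p_1(x)=x(x-1)$, $p_i(x)=x(p_{i-1}(x)-p_{i-2}(x))$ for $i\ge2$; $\alpha_i$ is the largest real root of $p_i$.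 Algorithm: input $\lambda,\Lambda,\varepsilon$. Set $\rho=\Lambda/\lambda$, $n=\lfloor\log_2\rho\rfloor$, $\gamma=2\cos(\pi/(n+3))$, $a_{-1}=1$. If $n+1>\log_\gamma\rho$, set $n\leftarrow n-1$. Set $\alpha_{n+1}=4\cos^2(\pi/(n+3))$, $\alpha_{n+2}=4\cos^2(\pi/(n+4))$. If $n\le3$: compute exactly (by radicals) $a_0\in[\alpha_{n+1},\alpha_{n+2}]$ with $p_n(a_0)=\rho$. Else if $n\ge 7\varepsilon^{-1/3}-4$: set $a_0=\alpha_{n+2}$. Else: find by a numerical root-finding method $a_0\in[\alpha_{n+1},\alpha_{n+2}]$ with $|p_n(a_0)-\rho|<\varepsilon$. Then for $1\le i\le n$ set $a_i=a_0(a_{i-1}-a_{i-2})$. Output the strategy $f$ with $f(i)=a_i\lambda$ for $0\le i<n$ and $f(i)=\Lambda$ for $i\ge n$ (the list $a_0\lambda,\dots,a_n\lambda,\Lambda$), together with the value $2a_0+1$.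
   Formalization: (a) is proved for ρ < 32cos^5(π/7) and (b) from equality on, since (a) fails at equality (n=4 there); the root-finding case's time is the root finder's time plus at most O(n), for any correct root finder; the log_γ test is skipped when γ=1 (n=0), where it is undefined. *)

(* Defs.v *)
From Stdlib Require Import Reals ZArith List String.
From Coquelicot Require Import Coquelicot.
Import ListNotations.

Open Scope R_scope.
Open Scope string_scope.

Definition strategy (f : nat -> R) : Prop := forall i, 0 < f i.

Definition is_finv (f : nat -> R) (D : R) (j : nat) : Prop :=
  D <= f j /\ forall i, (i < j)%nat -> f i < D.

(** A target that is never reached costs [p_infty]. *)
Definition is_phi (f : nat -> R) (D : R) (v : Rbar) : Prop :=
  (exists j, is_finv f D j /\ v = Finite (2 * sum_f_R0 f j + D)) \/
  ((forall j, f j < D) /\ v = p_infty).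

Definition CR (lam Lam : R) (f : nat -> R) : Rbar :=
  Rbar_lub (fun r => exists D v,
    lam <= D <= Lam /\ is_phi f D v /\ r = Rbar_div v (Finite D)).

Definition optimal (lam Lam : R) (f : nat -> R) : Prop :=
  strategy f /\
  forall g, strategy g -> Rbar_le (CR lam Lam f) (CR lam Lam g).

Fixpoint pol (i : nat) (x : R) : R :=
  match i with
  | O => x
  | S j => match j with
           | O => x * (x - 1)
           | S k => x * (pol j x - pol k x)
           end
  end.

Definition largest_root (i : nat) (a : R) : Prop :=
  pol i a = 0 /\ forall x, pol i x = 0 -> x <= a.

(** Real RAM: memory consists of arrays of reals, named by strings; a scalar is cell 0
    of an array.  A program mentions finitely many names, and a cell index is
    itself a computed number.  Constants, memory accesses, operations,
    comparisons and control steps cost one unit each. *)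

Inductive unop : Type :=
| UNeg | UFloor | URoot (k : nat) | ULn | UExp
| USin | UCos | UTan | UAsin | UAcos | UAtan.

Inductive binop : Type := BAdd | BSub | BMul | BDiv | BPow.

(** Stdlib's [Rpower] is 1 at base 0, hence the guards: roots and powers are
    those of a positive base, and 0 otherwise. *)
Definition rpow (x y : R) : R := if Rlt_dec 0 x then Rpower x y else 0.

Definition unop_val (o : unop) (x : R) : R :=
  match o with
  | UNeg => - x
  | UFloor => IZR (Int_part x)
  | URoot k => rpow x (/ INR k)
  | ULn => ln x
  | UExp => exp x
  | USin => sin x
  | UCos => cos x
  | UTan => tan x
  | UAsin => asin x
  | UAcos => acos x
  | UAtan => atan x
  end.

Definition binop_val (o : binop) (x y : R) : R :=
  match o with
  | BAdd => x + y
  | BSub => x - y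
  | BMul => x * y
  | BDiv => x / y
  | BPow => rpow x y
  end.

Inductive expr : Type :=
| Cst (c : R)
| Get (x : string) (i : expr)
| Un (o : unop) (e : expr)
| Bin (o : binop) (e1 e2 : expr).

Inductive test : Type :=
| TLt (e1 e2 : expr)
| TLe (e1 e2 : expr).

(** [Call x q args] runs [q] in a fresh memory holding only the arguments and
    stores the final value of its scalar ["result"] in [x]. *)
Inductive cmd : Type :=
| Skip
| Store (x : string) (i e : expr)
| Seq (c1 c2 : cmd)
| If (b : test) (c1 c2 : cmd)
| While (b : test) (c : cmd)
| Call (x : string) (q : cmd) (args : list (string * expr)).

Definition state : Type := string -> nat -> R.

Definition upd (s : state) (x : string) (i : nat) (v : R) : state :=
  fun y j => if (String.eqb x y && Nat.eqb i j)%bool then v else s y j.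

Definition init (args : list (string * R)) : state :=
  fold_right (fun a s => upd s (fst a) 0%nat (snd a)) (fun _ _ => 0) args.

Definition addr (v : R) : nat := Z.to_nat (Int_part v).

Fixpoint eval (s : state) (e : expr) : R :=
  match e with
  | Cst c => c
  | Get x i => s x (addr (eval s i))
  | Un o e1 => unop_val o (eval s e1)
  | Bin o e1 e2 => binop_val o (eval s e1) (eval s e2)
  end.

Fixpoint ecost (e : expr) : nat :=
  match e with
  | Cst _ => 1
  | Get _ i => S (ecost i)
  | Un _ e1 => S (ecost e1)
  | Bin _ e1 e2 => S (ecost e1 + ecost e2)
  end.

Definition holds (s : state) (b : test) : Prop :=
  match b with
  | TLt e1 e2 => eval s e1 < eval s e2
  | TLe e1 e2 => eval s e1 <= eval s e2
  end.

Definition tcost (b : test) : nat :=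
  match b with TLt e1 e2 | TLe e1 e2 => S (ecost e1 + ecost e2) end.

Definition eval_args (s : state) (args : list (string * expr)) :
  list (string * R) := map (fun a => (fst a, eval s (snd a))) args.

Definition args_cost (args : list (string * expr)) : nat :=
  fold_right (fun a m => (S (ecost (snd a)) + m)%nat) 0%nat args.

(** [exec c s t s']: started in [s], the program [c] halts in [s'] after
    exactly [t] unit-cost steps. *)
Inductive exec : cmd -> state -> nat -> state -> Prop :=
| ExSkip s : exec Skip s 1 s
| ExStore x i e s :
    exec (Store x i e) s (S (ecost i + ecost e))
      (upd s x (addr (eval s i)) (eval s e))
| ExSeq c1 c2 s1 s2 s3 t1 t2 :
    exec c1 s1 t1 s2 -> exec c2 s2 t2 s3 ->
    exec (Seq c1 c2) s1 (t1 + t2) s3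
| ExIfTrue b c1 c2 s t s' :
    holds s b -> exec c1 s t s' -> exec (If b c1 c2) s (tcost b + t) s'
| ExIfFalse b c1 c2 s t s' :
    ~ holds s b -> exec c2 s t s' -> exec (If b c1 c2) s (tcost b + t) s'
| ExWhileFalse b c s :
    ~ holds s b -> exec (While b c) s (tcost b) s
| ExWhileTrue b c s1 s2 s3 t1 t2 :
    holds s1 b -> exec c s1 t1 s2 -> exec (While b c) s2 t2 s3 ->
    exec (While b c) s1 (tcost b + t1 + t2) s3
| ExCall x q args s t s' :
    exec q (init (eval_args s args)) t s' ->
    exec (Call x q args) s (S (args_cost args + t))
      (upd s x 0%nat (s' "result" 0%nat)).

Declare Scope expr_scope.
Delimit Scope expr_scope with expr.
Bind Scope expr_scope with expr.
Coercion Cst : R >-> expr.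
Notation "$ x" := (Get x (Cst 0)) (at level 1, format "$ x") : expr_scope.
Notation "e1 + e2" := (Bin BAdd e1 e2) : expr_scope.
Notation "e1 - e2" := (Bin BSub e1 e2) : expr_scope.
Notation "e1 * e2" := (Bin BMul e1 e2) : expr_scope.
Notation "e1 / e2" := (Bin BDiv e1 e2) : expr_scope.
Notation "e1 ^ e2" := (Bin BPow e1 e2) : expr_scope.
Notation sqrtE e := (Un (URoot 2) e%expr).
Notation cbrtE e := (Un (URoot 3) e%expr).
Notation lnE e := (Un ULn e%expr).
Notation cosE e := (Un UCos e%expr).
Notation floorE e := (Un UFloor e%expr).

Declare Scope cmd_scope.
Delimit Scope cmd_scope with cmd.
Bind Scope cmd_scope with cmd.
Notation "x <~ e" := (Store x (Cst 0) e%expr) (at level 80) : cmd_scope.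
Notation "c1 ;; c2" := (Seq c1 c2)
  (at level 90, right associativity) : cmd_scope.
Notation "e1 <? e2" := (TLt e1%expr e2%expr) (at level 70) : cmd_scope.
Notation "e1 <=? e2" := (TLe e1%expr e2%expr) (at level 70) : cmd_scope.

(** The root [a0 >= 1] of [pol n a0 = rho] by radicals, for [n <= 3] and
    [rho >= pol n alpha_(n+1)].
    [n = 2]: with [x = y + 2/3], [x^3 - 2 x^2 = rho] becomes
      [y^3 - (4/3) y = rho + 16/27], solved by Cardano's formula.
    [n = 3]: Ferrari's method for [x^4 - 3 x^3 + x^2 = rho].  The resolvent
      [m^3 - m^2/2 + rho m + 5 rho/8 = 0] becomes, with [m = z + 1/6],
      [z^3 + (rho - 1/12) z + (19 rho/24 - 1/108) = 0]; for its real root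
      [m] and [s = sqrt (5/4 + 2 m)], [a0] is the positive root of
      [x^2 - (3/2) x + m = s x - 3 m / (2 s)]. *)
Definition solve_by_radicals : cmd :=
  (If ($"n" <=? 0)
    ("a0" <~ $"rho")
  (If ($"n" <=? 1)
    ("a0" <~ (1 + sqrtE (1 + 4 * $"rho")) / 2)
  (If ($"n" <=? 2)
    ("q" <~ ($"rho" + 16 / 27) / 2 ;;
     "d" <~ sqrtE ($"q" * $"q" - 64 / 729) ;;
     "a0" <~ 2 / 3 + cbrtE ($"q" + $"d") + cbrtE ($"q" - $"d"))
    ("P" <~ ($"rho" - 1 / 12) / 3 ;;
     "q" <~ (19 * $"rho" / 24 - 1 / 108) / 2 ;;
     "d" <~ sqrtE ($"q" * $"q" + $"P" * $"P" * $"P") ;;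
     "m" <~ 1 / 6 + cbrtE ($"d" - $"q") - cbrtE ($"d" + $"q") ;;
     "s" <~ sqrtE (5 / 4 + 2 * $"m") ;;
     "b" <~ 3 / 2 + $"s" ;;
     "c" <~ $"m" + 3 * $"m" / (2 * $"s") ;;
     "a0" <~ ($"b" + sqrtE ($"b" * $"b" - 4 * $"c")) / 2))))%cmd.

(** Cell [i + 1] of the array ["a"] holds [a_i], so that [a_(-1)] has a cell.
    The guard [1 < gamma] only excludes [n = 0], where [gamma = 1] and there is
    no logarithm to base [gamma].  [Q] is the numerical root-finding method. *)
Definition algorithm (Q : cmd) : cmd :=
  ("rho" <~ $"Lambda" / $"lambda" ;;
   "n" <~ floorE (lnE ($"rho") / lnE 2) ;;
   "gamma" <~ 2 * cosE (PI / ($"n" + 3)) ;;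
   Store "a" 0 1 ;;
   If (1 <? $"gamma")
     (If (lnE ($"rho") / lnE ($"gamma") <? $"n" + 1)
       ("n" <~ $"n" - 1)
       Skip)
     Skip ;;
   "lo" <~ 4 * cosE (PI / ($"n" + 3)) * cosE (PI / ($"n" + 3)) ;;
   "hi" <~ 4 * cosE (PI / ($"n" + 4)) * cosE (PI / ($"n" + 4)) ;;
   If ($"n" <=? 3)
     solve_by_radicals
   (If (7 * $"eps" ^ (-1 / 3)%R - 4 <=? $"n")
     ("a0" <~ $"hi")
     (Call "a0" Q [("n", $"n"); ("rho", $"rho"); ("eps", $"eps");
                   ("lo", $"lo"); ("hi", $"hi")]%expr)) ;;
   Store "a" 1 ($"a0") ;;
   "i" <~ 1 ;;
   While ($"i" <=? $"n")
     (Store "a" ($"i" + 1)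
        ($"a0" * (Get "a" ($"i") - Get "a" ($"i" - 1))) ;;
      "i" <~ $"i" + 1) ;;
   "i" <~ 0 ;;
   While ($"i" <? $"n")
     (Store "f" ($"i") (Get "a" ($"i" + 1) * $"lambda") ;;
      "i" <~ $"i" + 1) ;;
   Store "f" ($"n") ($"Lambda") ;;
   "value" <~ 2 * $"a0" + 1)%cmd.

Definition input (lam Lam eps : R) : state :=
  init [("lambda", lam); ("Lambda", Lam); ("eps", eps)].

Definition output_n (s : state) : R := s "n" 0%nat.

(** The output is the list [f 0, ..., f n] in the array ["f"]; the strategy
    repeats its last entry for ever. *)
Definition output_strategy (s : state) : nat -> R :=
  fun i => s "f" (Nat.min i (addr (output_n s))).

Definition root_input (n : nat) (rho eps lo hi : R) : state :=
  init [("n", INR n); ("rho", rho); ("eps", eps); ("lo", lo); ("hi", hi)].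

(** [Q] solves [pol n x = rho] on [alpha_(n+1), alpha_(n+2)) to accuracy [eps],
    for the instances on which the algorithm calls a root-finding method. *)
Definition root_finder (Q : cmd) : Prop :=
  forall (n : nat) (rho eps lo hi : R),
    (4 <= n)%nat -> 0 < eps -> INR n < 7 * Rpower eps (-1 / 3) - 4 ->
    largest_root (n + 1) lo -> largest_root (n + 2) hi ->
    pol n lo <= rho < pol n hi ->
    exists t s, exec Q (root_input n rho eps lo hi) t s /\
      lo <= s "result" 0%nat <= hi /\
      Rabs (pol n (s "result" 0%nat) - rho) < eps.

(* Main.v *)
(** For [x = 4 cos^2 t] the recurrence [a_i = x (a_(i-1) - a_(i-2))] gives
    [pol i x = (2 cos t)^(i+1) sin ((i+2) t) / sin t].  Hence [pol i] has largest
    root [alpha_i = 4 cos^2 (PI / (i+2))], and [pol n] maps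
    [alpha_(n+1), alpha_(n+2)) onto [th_n, th_(n+1)) with
    [th_n = (2 cos (PI / (n+3)))^(n+1)].  As [2^n <= th_n < 2^(n+1)], the index
    [n] with [rho] in that interval is [floor (log2 rho)] or one less.

    The sums of a recurrent strategy telescope to [a_0 + ... + a_j = a_0 a_(j-1)],
    so its ratio is [1 + 2 a_0].  Conversely, if a strategy has ratio [1 + 2 c],
    then its sum up to each record is at most [c] times the previous record.
    Comparing the growth of these sums with that of the extremal sequence shows
    that the [k]-th record is at most [lambda pol k c], and [Lambda] is reached
    only if [c >= a_0].

    If [a_0] is inexact, the error is controlled by
    [pol n x / pol n y >= x / y] for [x >= y >= alpha_(n+1)], which comes from the same
    comparison, and by [alpha_(n+2) - alpha_(n+1) = O(n^-3)]. *)

From Stdlib Require Import Arith ZArith Reals List String Lra Lia.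
From Coquelicot Require Import Coquelicot.
Require Import Defs.
Open Scope R_scope.
Open Scope string_scope.
Import ListNotations.

(** * The polynomials *)

(* The recurrence of [pol] started two steps earlier, at [a_(-2) = 0] and
   [a_(-1) = 1]. *)
Fixpoint qpol (k : nat) (x : R) : R :=
  match k with
  | O => 0
  | S j => match j with
           | O => 1
           | S l => x * (qpol j x - qpol l x)
           end
  end.

Lemma qpol_SS (k : nat) (x : R) :
  qpol (S (S k)) x = x * (qpol (S k) x - qpol k x).
Proof. reflexivity. Qed.

Lemma pol_qpol (i : nat) (x : R) : pol i x = qpol (S (S i)) x.
Proof.
  assert (H : pol i x = qpol (S (S i)) x /\ pol (S i) x = qpol (S (S (S i))) x).
  { induction i as [|i [IH1 IH2]].
    - split; simpl; ring.
    - split; [exact IH2|].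
      change (pol (S (S i)) x) with (x * (pol (S i) x - pol i x)).
      rewrite qpol_SS, IH1, IH2; reflexivity. }
  apply H.
Qed.

(** The terms [pol i x = x * (qpol (i+1) x - qpol i x)] telescope, and [qpol 0 x = 0]. *)
Lemma sum_pol (j : nat) (x : R) :
  sum_f_R0 (fun i => pol i x) j = x * qpol (S j) x.
Proof.
  induction j as [|j IH]; [simpl; ring|].
  rewrite tech5, IH, pol_qpol, (qpol_SS (S j)); ring.
Qed.

(** The ratio [r_k = qpol (k+1) x / qpol k x] satisfies [r_(k+1) = x (1 - 1 / r_k)], which increases
    with both [x] and [r_k]. Hence the ratios at [a] dominate those at [c]. The comparison is
    cross-multiplied, and positivity at [a] comes out of the same induction. *)
Lemma qpol_ratio_mono (c a : R) (k : nat) :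
  0 < c < a ->
  (forall i, (1 <= i <= S (S k))%nat -> 0 < qpol i c) ->
  0 < qpol (S k) a /\ 0 < qpol (S (S k)) a /\
  qpol (S (S k)) c * qpol (S k) a < qpol (S (S k)) a * qpol (S k) c.
Proof.
  intros Hca; induction k as [|k IH]; intros Hpos.
  - simpl; lra.
  - destruct IH as (H1 & H2 & H3); [intros i Hi; apply Hpos; lia|].
    assert (P1 : 0 < qpol (S k) c) by (apply Hpos; lia).
    assert (P2 : 0 < qpol (S (S k)) c) by (apply Hpos; lia).
    assert (P3 : 0 < qpol (S (S (S k))) c) by (apply Hpos; lia).
    rewrite qpol_SS in P3.
    rewrite !(qpol_SS (S k)).
    set (u := qpol (S k) c) in *; set (v := qpol (S (S k)) c) in *.
    set (u' := qpol (S k) a) in *; set (v' := qpol (S (S k)) a) in *.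
    assert (Huv : 0 < v - u) by nra.
    assert (Hv : u' < v').
    { apply Rmult_lt_reg_r with v; [exact P2|]. nra. }
    split; [exact H2|]. split; [nra|].
    assert ((v - u) * v' < (v' - u') * v) by nra.
    assert (0 < (v - u) * v') by nra.
    nra.
Qed.

Lemma qpol_pos_mono (c a : R) (k : nat) :
  0 < c < a ->
  (forall i, (1 <= i <= k)%nat -> 0 < qpol i c) ->
  forall i, (1 <= i <= k)%nat -> 0 < qpol i a.
Proof.
  intros Hca Hpos i Hi.
  destruct i as [|[|i]]; [lia|simpl; lra|].
  apply (qpol_ratio_mono c a i Hca).
  intros j Hj; apply Hpos; lia.
Qed.

(** Multiplies the ratio comparisons together, starting from [qpol 2 x = x]; so [qpol] grows at
    least linearly in [x]. *)
Lemma qpol_growth (c a : R) (k : nat) :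
  0 < c < a ->
  (forall i, (1 <= i <= S (S k))%nat -> 0 < qpol i c) ->
  qpol (S (S k)) c * a <= qpol (S (S k)) a * c.
Proof.
  intros Hca; induction k as [|k IH]; intros Hpos.
  - simpl; lra.
  - assert (H1 : qpol (S (S k)) c * a <= qpol (S (S k)) a * c)
      by (apply IH; intros i Hi; apply Hpos; lia).
    destruct (qpol_ratio_mono c a (S k) Hca Hpos) as (H2 & H3 & H4).
    assert (P1 : 0 < qpol (S (S k)) c) by (apply Hpos; lia).
    assert (P2 : 0 < qpol (S (S (S k))) c) by (apply Hpos; lia).
    apply Rmult_le_reg_r with (qpol (S (S k)) c); [exact P1|].
    apply Rle_trans with (qpol (S (S (S k))) c * (qpol (S (S k)) a * c)); nra.
Qed.

Lemma pol_lt_mono (c a : R) (k : nat) :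
  0 < c < a ->
  (forall i, (1 <= i <= S (S k))%nat -> 0 < qpol i c) ->
  pol k c < pol k a.
Proof.
  intros Hca Hpos; rewrite !pol_qpol.
  assert (H := qpol_growth c a k Hca Hpos).
  assert (P : 0 < qpol (S (S k)) c) by (apply Hpos; lia).
  nra.
Qed.

(* These sign conditions say that [a] lies between the largest roots of
   [pol (n + 1)] and [pol (n + 2)]. *)
Definition in_bracket (n : nat) (a : R) : Prop :=
  0 < a /\ (forall i, (1 <= i <= S (S n))%nat -> 0 < qpol i a) /\
  0 <= qpol (S (S (S n))) a /\ qpol (S (S (S (S n)))) a <= 0.

(** An increment [qpol (j+1) a - qpol j a] is [qpol (j+2) a / a], so the sign conditions up to index
    [n + 3] give monotonicity up to [n + 2]. *)
Lemma qpol_nondecreasing (n : nat) (a : R) :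
  in_bracket n a ->
  forall i j, (i <= j <= S (S n))%nat -> qpol i a <= qpol j a.
Proof.
  intros (Ha & Hpos & H3 & _) i j [Hij Hj].
  induction Hij as [|j Hij IH]; [lra|].
  apply Rle_trans with (qpol j a); [apply IH; lia|].
  assert (H : 0 <= qpol (S (S j)) a).
  { destruct (Nat.eq_dec j (S n)) as [->|]; [exact H3|].
    left; apply Hpos; lia. }
  rewrite qpol_SS in H; nra.
Qed.

(** * Trigonometric closed form and largest roots *)

Lemma qpol_trig (th : R) (k : nat) :
  2 * cos th * qpol k (4 * cos th * cos th) * sin th =
  (2 * cos th) ^ k * sin (INR k * th).
Proof.
  assert (H : forall x, sin (x * th + 2 * th) =
    2 * cos th * sin (x * th + th) - sin (x * th)).
  { intros x. rewrite !sin_plus, sin_2a, cos_2a.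
    assert (E := sin2_cos2 th); unfold Rsqr in E.
    replace (sin th * sin th) with (1 - cos th * cos th) by lra. ring. }
  assert (HH : 2 * cos th * qpol k (4 * cos th * cos th) * sin th =
    (2 * cos th) ^ k * sin (INR k * th) /\
    2 * cos th * qpol (S k) (4 * cos th * cos th) * sin th =
    (2 * cos th) ^ (S k) * sin (INR (S k) * th)).
  { induction k as [|k [IH1 IH2]].
    - split; simpl; [rewrite Rmult_0_l, sin_0; ring|].
      rewrite Rmult_1_l; ring.
    - split; [exact IH2|]. rewrite qpol_SS.
      replace (INR (S (S k)) * th) with (INR k * th + 2 * th)
        by (rewrite !S_INR; ring).
      rewrite H.
      replace (INR (S k) * th) with (INR k * th + th) in IH2
        by (rewrite S_INR; ring).
      replace (2 * cos th * (4 * cos th * cos th * (qpol (S k) (4 * cos th * cos th)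
        - qpol k (4 * cos th * cos th))) * sin th) with
        (4 * cos th * cos th * (2 * cos th * qpol (S k) (4 * cos th * cos th) * sin th
          - 2 * cos th * qpol k (4 * cos th * cos th) * sin th)) by ring.
      rewrite IH1, IH2. simpl; ring. }
  apply HH.
Qed.

Definition alpha (i : nat) : R :=
  4 * cos (PI / (INR i + 2)) * cos (PI / (INR i + 2)).

Lemma angle_bounds (i : nat) : (1 <= i)%nat -> 0 < PI / (INR i + 2) < PI / 2.
Proof.
  intros Hi; apply le_INR in Hi; simpl in Hi.
  assert (P := PI_RGT_0).
  split.
  - apply Rdiv_lt_0_compat; lra.
  - apply Rmult_lt_compat_l; [exact P|]. apply Rinv_lt_contravar; lra.
Qed.

Lemma cos_angle_pos (i : nat) : (1 <= i)%nat -> 0 < cos (PI / (INR i + 2)).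
Proof. intros Hi; destruct (angle_bounds i Hi); apply cos_gt_0; lra. Qed.

Lemma sin_angle_pos (i : nat) : (1 <= i)%nat -> 0 < sin (PI / (INR i + 2)).
Proof.
  intros Hi; destruct (angle_bounds i Hi).
  assert (P := PI_RGT_0). apply sin_gt_0; lra.
Qed.

Lemma alpha_pos (i : nat) : (1 <= i)%nat -> 0 < alpha i.
Proof. intros Hi; assert (H := cos_angle_pos i Hi); unfold alpha; nra. Qed.

(** For these [k] the angle [k PI / (i + 2)] lies strictly between 0 and [PI]. *)
Lemma qpol_alpha_pos (i k : nat) :
  (1 <= i)%nat -> (1 <= k <= S i)%nat -> 0 < qpol k (alpha i).
Proof.
  intros Hi Hk.
  assert (H := qpol_trig (PI / (INR i + 2)) k); fold (alpha i) in H.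
  assert (Hc := cos_angle_pos i Hi). assert (Hs := sin_angle_pos i Hi).
  destruct (angle_bounds i Hi) as [A1 A2].
  assert (0 < sin (INR k * (PI / (INR i + 2)))).
  { assert (K1 : 1 <= INR k) by (apply (le_INR 1); lia).
    assert (K2 : INR k <= INR i + 1) by (rewrite <- S_INR; apply le_INR; lia).
    apply sin_gt_0; [nra|].
    replace PI with ((INR i + 2) * (PI / (INR i + 2))) at 2
      by (field; assert (X := pos_INR i); lra).
    apply Rmult_lt_compat_r; lra. }
  assert (0 < (2 * cos (PI / (INR i + 2))) ^ k) by (apply pow_lt; lra).
  assert (HH : 0 < 2 * cos (PI / (INR i + 2)) * qpol k (alpha i) *
    sin (PI / (INR i + 2))) by (rewrite H; nra).
  replace (2 * cos (PI / (INR i + 2)) * qpol k (alpha i) *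
    sin (PI / (INR i + 2))) with
    (qpol k (alpha i) * (2 * cos (PI / (INR i + 2)) * sin (PI / (INR i + 2)))) in HH by ring.
  assert (0 < 2 * cos (PI / (INR i + 2)) * sin (PI / (INR i + 2))) by nra.
  nra.
Qed.

Lemma qpol_alpha_root (i : nat) : (1 <= i)%nat -> qpol (S (S i)) (alpha i) = 0.
Proof.
  intros Hi.
  assert (H := qpol_trig (PI / (INR i + 2)) (S (S i))); fold (alpha i) in H.
  replace (INR (S (S i)) * (PI / (INR i + 2))) with PI in H
    by (rewrite !S_INR; field; assert (X := pos_INR i); lra).
  rewrite sin_PI, Rmult_0_r in H.
  assert (Hc := cos_angle_pos i Hi). assert (Hs := sin_angle_pos i Hi).
  apply Rmult_integral in H as [H|H]; [|lra].
  apply Rmult_integral in H as [H|H]; lra.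
Qed.

(** Up to index [i + 1] positivity is inherited from [alpha i]. At [alpha i] the ratio
    [qpol (i+1) / qpol i] is exactly 1, since the next term vanishes; beyond [alpha i] it exceeds 1,
    so the next term is positive there. *)
Lemma qpol_above_alpha (i : nat) (x : R) :
  (1 <= i)%nat -> alpha i < x ->
  forall k, (1 <= k <= S (S i))%nat -> 0 < qpol k x.
Proof.
  intros Hi Hx.
  assert (Ha := alpha_pos i Hi).
  assert (Hr := qpol_alpha_root i Hi).
  assert (Hp : forall k, (1 <= k <= S i)%nat -> 0 < qpol k x).
  { apply (qpol_pos_mono (alpha i) x); [lra|].
    intros; apply qpol_alpha_pos; lia. }
  intros k Hk. destruct (Nat.eq_dec k (S (S i))) as [->|]; [|apply Hp; lia].
  destruct i as [|i]; [lia|].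
  destruct (qpol_ratio_mono (alpha (S i)) x i) as (H1 & H2 & H3); [lra| |].
  { intros; apply qpol_alpha_pos; lia. }
  rewrite qpol_SS in Hr |- *.
  assert (E : qpol (S (S i)) (alpha (S i)) = qpol (S i) (alpha (S i))) by nra.
  assert (P : 0 < qpol (S i) (alpha (S i))) by (apply qpol_alpha_pos; lia).
  rewrite E in H3. nra.
Qed.

Lemma largest_root_alpha (i : nat) : (1 <= i)%nat -> largest_root i (alpha i).
Proof.
  intros Hi; split.
  - rewrite pol_qpol; apply qpol_alpha_root; exact Hi.
  - intros x Hx. destruct (Rle_dec x (alpha i)) as [|Hn]; [assumption|].
    rewrite pol_qpol in Hx.
    assert (0 < qpol (S (S i)) x)
      by (apply (qpol_above_alpha i); [exact Hi|lra|lia]).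
    lra.
Qed.

Lemma in_bracket_alpha (n : nat) (a : R) :
  alpha (S n) <= a <= alpha (S (S n)) -> in_bracket n a.
Proof.
  intros [H1 H2].
  assert (A1 : 0 < alpha (S n)) by (apply alpha_pos; lia).
  assert (R1 : qpol (S (S (S n))) (alpha (S n)) = 0)
    by (apply qpol_alpha_root; lia).
  destruct (Rle_lt_or_eq_dec _ _ H1) as [L|E].
  - assert (P : forall i, (1 <= i <= S (S (S n)))%nat -> 0 < qpol i a)
      by (apply qpol_above_alpha; [lia|exact L]).
    repeat split; [lra|intros; apply P; lia|left; apply P; lia|].
    assert (R2 : qpol (S (S (S (S n)))) (alpha (S (S n))) = 0)
      by (apply qpol_alpha_root; lia).
    destruct (Rle_lt_or_eq_dec _ _ H2) as [L2|E2]; [|rewrite E2; lra].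
    (* A positive value at [a] would carry over to the larger point [alpha (n+2)], which is a
       root. *)
    apply Rnot_lt_le; intros Hc.
    assert (0 < qpol (S (S (S (S n)))) (alpha (S (S n)))); [|lra].
    apply (qpol_pos_mono a _ (S (S (S (S n))))); [lra| |lia].
    intros i Hi. destruct (Nat.eq_dec i (S (S (S (S n))))) as [->|]; [exact Hc|].
    apply P; lia.
  - subst a. repeat split; [lra|intros; apply qpol_alpha_pos; lia|lra|].
    rewrite qpol_SS, R1.
    assert (0 < qpol (S (S n)) (alpha (S n))) by (apply qpol_alpha_pos; lia).
    nra.
Qed.

Definition threshold (n : nat) : R := (2 * cos (PI / (INR n + 3))) ^ (S n).

(** With [t = PI / (n+3)], the angle [(n+2) t] is [PI - t], and the two sines cancel. *)
Lemma pol_alpha_lower (n : nat) : pol n (alpha (S n)) = threshold n.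
Proof.
  rewrite pol_qpol. unfold threshold.
  assert (E : INR n + 3 = INR (S n) + 2) by (rewrite S_INR; ring). rewrite E.
  assert (Hc := cos_angle_pos (S n) ltac:(lia)).
  assert (Hs := sin_angle_pos (S n) ltac:(lia)).
  assert (H := qpol_trig (PI / (INR (S n) + 2)) (S (S n))).
  fold (alpha (S n)) in H.
  replace (INR (S (S n)) * (PI / (INR (S n) + 2))) with
    (PI - PI / (INR (S n) + 2)) in H
    by (rewrite (S_INR (S n)); field; assert (X := pos_INR (S n)); lra).
  rewrite sin_PI_x in H.
  apply Rmult_eq_reg_r in H; [|lra].
  rewrite <- tech_pow_Rmult in H. apply Rmult_eq_reg_l in H; lra.
Qed.

(** With [t = PI / (n+4)], the angle [(n+2) t] is [PI - 2 t]; the double-angle formula supplies one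
    more factor [2 cos t], which makes the value the next threshold. *)
Lemma pol_alpha_upper (n : nat) : pol n (alpha (S (S n))) = threshold (S n).
Proof.
  rewrite pol_qpol. unfold threshold.
  assert (E : INR (S n) + 3 = INR (S (S n)) + 2) by (rewrite (S_INR (S n)); ring).
  rewrite E.
  assert (Hc := cos_angle_pos (S (S n)) ltac:(lia)).
  assert (Hs := sin_angle_pos (S (S n)) ltac:(lia)).
  assert (H := qpol_trig (PI / (INR (S (S n)) + 2)) (S (S n))).
  fold (alpha (S (S n))) in H.
  replace (INR (S (S n)) * (PI / (INR (S (S n)) + 2))) with
    (PI - 2 * (PI / (INR (S (S n)) + 2))) in H
    by (field; assert (X := pos_INR (S (S n))); lra).
  rewrite sin_PI_x, sin_2a in H.
  set (c := cos (PI / (INR (S (S n)) + 2))) in *.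
  set (s := sin (PI / (INR (S (S n)) + 2))) in *.
  apply Rmult_eq_reg_r with (2 * c * s); [|nra].
  rewrite <- tech_pow_Rmult in *. lra.
Qed.

(** * Competitive ratio *)

Lemma least_index (P : nat -> Prop) (N : nat) :
  P N ->
  exists j, P j /\ forall i, (i < j)%nat -> ~ P i.
Proof.
  revert N.
  apply (well_founded_induction lt_wf (fun N => P N -> _)).
  intros N IH HN.
  destruct (Classical_Prop.classic (exists i, (i < N)%nat /\ P i)) as [(i & Hi & Pi)|H].
  - exact (IH i Hi Pi).
  - exists N; split; [exact HN|]. intros i Hi Pi; apply H; exists i; auto.
Qed.

Lemma sum_f_R0_lt (g : nat -> R) (i j : nat) :
  (forall k, 0 < g k) -> (i < j)%nat -> sum_f_R0 g i + g j <= sum_f_R0 g j.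
Proof.
  intros Hg Hij. induction j as [|j IH]; [lia|].
  rewrite tech5. destruct (Nat.eq_dec i j) as [->|]; [lra|].
  assert (H := IH ltac:(lia)). assert (X := Hg j). lra.
Qed.

Lemma last_le_sum (g : nat -> R) (j : nat) :
  (forall k, 0 < g k) -> g j <= sum_f_R0 g j.
Proof.
  intros Hg. destruct j as [|j]; [simpl; lra|].
  rewrite tech5. assert (H := sum_f_R0_lt g 0 (S j) Hg ltac:(lia)).
  rewrite tech5 in H. simpl in H. assert (X := Hg 0%nat). lra.
Qed.

(** A target found in round [j + 1] is farther than [f j], and one found in round 0 is at least
    [lam] away. So the sums need only be compared with the previous entry, or with [lam]. *)
Lemma CR_le (lam Lam B : R) (n : nat) (f : nat -> R) :
  0 < lam -> 0 <= B ->
  Lam <= f n ->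
  f 0%nat <= B * lam ->
  (forall j, (j < n)%nat -> sum_f_R0 f (S j) <= B * f j) ->
  Rbar_le (CR lam Lam f) (Finite (1 + 2 * B)).
Proof.
  intros Hl HB Hn H0 Hj. unfold CR.
  match goal with |- Rbar_le (Rbar_lub ?E) _ =>
    destruct (proj2_sig (Rbar_ex_lub E)) as [_ Hlub] end.
  apply Hlub; clear Hlub.
  intros r (D & v & HD & Hphi & ->).
  destruct Hphi as [(j & [Hfj Hmin] & ->)|[Hnr _]].
  - assert (Hjn : (j <= n)%nat).
    { apply Nat.nlt_ge; intros Hlt. assert (X := Hmin n Hlt). lra. }
    assert (HS : sum_f_R0 f j <= B * D).
    { destruct j as [|j].
      - simpl. nra.
      - assert (X := Hj j ltac:(lia)). assert (Y := Hmin j ltac:(lia)). nra. }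
    simpl. apply Rmult_le_reg_r with D; [lra|].
    rewrite Rmult_assoc, Rinv_l by lra. lra.
  - assert (X := Hnr n). lra.
Qed.

(** * Lower bound for arbitrary strategies *)

Section LowerBound.

Variables (lam Lam c : R) (g : nat -> R).
Hypotheses (Hl : 0 < lam <= Lam) (Hg : forall i, 0 < g i).
Hypothesis Hcr : Rbar_le (CR lam Lam g) (Finite (1 + 2 * c)).

Lemma CR_target_bound (D : R) (v : Rbar) :
  lam <= D <= Lam -> is_phi g D v ->
  Rbar_le (Rbar_div v (Finite D)) (Finite (1 + 2 * c)).
Proof.
  intros HD Hv. apply Rbar_le_trans with (2 := Hcr). unfold CR.
  match goal with |- Rbar_le _ (Rbar_lub ?E) =>
    destruct (proj2_sig (Rbar_ex_lub E)) as [Hub _] end.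
  apply Hub. exists D, v; auto.
Qed.

Lemma CR_sum_bound (D : R) (j : nat) :
  lam <= D <= Lam -> is_finv g D j -> sum_f_R0 g j <= c * D.
Proof.
  intros HD Hj.
  assert (H := CR_target_bound D _ HD (or_introl (ex_intro _ j (conj Hj eq_refl)))).
  simpl in H. apply Rmult_le_compat_r with (r := D) in H; [|lra].
  rewrite Rmult_assoc, Rinv_l in H by lra. lra.
Qed.

Lemma CR_reaches (D : R) : lam <= D <= Lam -> exists j, D <= g j.
Proof.
  intros HD. apply Classical_Prop.NNPP; intros Hn.
  assert (H := CR_target_bound D p_infty HD).
  assert (HH : Rbar_div p_infty (Finite D) = p_infty).
  { apply is_Rbar_mult_unique, is_Rbar_mult_p_infty_pos. simpl.
    apply Rinv_0_lt_compat; lra. }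
  rewrite HH in H. apply H. right; split; [|reflexivity].
  intros j. apply Rnot_le_lt. intros X; apply Hn; exists j; exact X.
Qed.

Lemma CR_next_record (j : nat) :
  lam <= g j < Lam -> (forall i, (i <= j)%nat -> g i <= g j) ->
  exists j', (j < j')%nat /\ (forall i, (i <= j')%nat -> g i <= g j') /\
    g j < g j' /\ sum_f_R0 g j' <= c * g j.
Proof.
  intros Hgj Hmax.
  destruct (CR_reaches Lam) as [N HN]; [lra|].
  destruct (least_index (fun i => g j < g i) N) as (j' & H1 & H2).
  { lra. }
  assert (Hle : forall i, (i < j')%nat -> g i <= g j)
    by (intros i Hi; apply Rnot_lt_le; auto).
  exists j'. repeat split; [| |exact H1|].
  - apply Nat.nle_gt; intros X; apply Hmax in X; lra.
  - intros i Hi. destruct (Nat.eq_dec i j') as [->|]; [lra|].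
    assert (X := Hle i ltac:(lia)); lra.
  - apply Rnot_lt_le; intros Hs.
    (* Targets just beyond the record [g j] are only found in round [j'], so
       the bound [sum <= c D] holds as [D] decreases to [g j]. *)
    assert (Hfinv : forall D, g j < D <= Rmin (g j') Lam -> sum_f_R0 g j' <= c * D).
    { intros D [D1 D2]. assert (X := Rmin_l (g j') Lam). assert (Y := Rmin_r (g j') Lam).
      apply CR_sum_bound; [lra|]. split; [lra|].
      intros i Hi; assert (Z := Hle i Hi); lra. }
    set (M := Rmin (g j') Lam) in *.
    assert (HM : g j < M) by (apply Rmin_glb_lt; lra).
    assert (HMs := Hfinv M ltac:(lra)).
    (* The sum is above [c * g j] and at most [c * M], with [g j < M]. *)
    assert (Hc : 0 < c) by nra.
    (* This target is beyond [g j] but below [sum / c], hence contradicts [Hfinv]. *)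
    set (D := Rmin M ((g j + sum_f_R0 g j' / c) / 2)).
    assert (HD : g j < sum_f_R0 g j' / c).
    { apply Rmult_lt_reg_r with c; [exact Hc|]. unfold Rdiv.
      rewrite Rmult_assoc, Rinv_l; lra. }
    assert (HD1 : g j < D) by (apply Rmin_glb_lt; lra).
    assert (X := Rmin_l M ((g j + sum_f_R0 g j' / c) / 2)).
    assert (Y := Rmin_r M ((g j + sum_f_R0 g j' / c) / 2)).
    fold D in X, Y.
    assert (HH := Hfinv D ltac:(lra)).
    assert (HE : sum_f_R0 g j' = c * (sum_f_R0 g j' / c)) by (field; lra).
    nra.
Qed.

(* The extremal strategy has [k]-th partial sum [c lam qpol (k + 1) c].  The
   partial sum of [g] up to its [k]-th record [g j] is compared with it, and
   its growth since the previous record, where it was [T], with the ratio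
   [qpol (k + 1) c / qpol k c]. *)
Definition record_bound (k : nat) : Prop :=
  exists (j : nat) (T : R),
    lam <= g j /\ (forall i, (i <= j)%nat -> g i <= g j) /\
    g j <= sum_f_R0 g j - T /\
    sum_f_R0 g j * qpol k c <= T * qpol (S k) c /\
    sum_f_R0 g j <= c * lam * qpol (S k) c /\
    (forall i, (1 <= i <= S (S k))%nat -> 0 < qpol i c) /\
    g j <= lam * pol k c.

(** Substituting [s * qpol k c <= T * qpol (k+1) c] into [s * qpol (k+2) c = s * c * (qpol (k+1) c -
    qpol k c)] gives the last inequality. Its left side is positive, hence so is [qpol (k+2) c]; the
    bound on [s] then turns it into the bound on [x]. *)
Lemma record_value_bound (k : nat) (x s T : R) :
  0 < c -> 0 < s -> 0 < x <= s - T ->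
  s * qpol k c <= T * qpol (S k) c ->
  s <= c * lam * qpol (S k) c ->
  (forall i, (1 <= i <= S k)%nat -> 0 < qpol i c) ->
  (forall i, (1 <= i <= S (S k))%nat -> 0 < qpol i c) /\
  x <= lam * pol k c /\
  (s - T) * c * qpol (S k) c <= s * qpol (S (S k)) c.
Proof.
  intros Hc Hs Hx H1 H2 Hpos.
  assert (P := Hpos (S k) ltac:(lia)).
  rewrite pol_qpol.
  assert (H3 : (s - T) * c * qpol (S k) c <= s * qpol (S (S k)) c)
    by (rewrite qpol_SS; nra).
  assert (P2 : 0 < qpol (S (S k)) c).
  { assert (0 < (s - T) * c * qpol (S k) c)
      by (repeat apply Rmult_lt_0_compat; lra).
    nra. }
  split; [|split; [|exact H3]].
  - intros i Hi. destruct (Nat.eq_dec i (S (S k))) as [->|]; [exact P2|].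
    apply Hpos; lia.
  - assert (Q : 0 < c * qpol (S k) c) by nra.
    apply Rmult_le_reg_r with (c * qpol (S k) c); [exact Q|].
    apply Rle_trans with (s * qpol (S (S k)) c); [|nra].
    apply Rle_trans with (2 := H3). nra.
Qed.

(** The record is the round that finds a target at distance [lam]. Taking [T = 0] is consistent
    because [qpol 0 c = 0]. *)
Lemma record_bound_0 : record_bound 0.
Proof.
  destruct (CR_reaches lam) as [N HN]; [lra|].
  destruct (least_index (fun i => lam <= g i) N) as (j & H1 & H2).
  { exact HN. }
  assert (H3 : forall i, (i < j)%nat -> g i < lam)
    by (intros i Hi; apply Rnot_le_lt; auto).
  assert (HS := CR_sum_bound lam j ltac:(lra) (conj H1 H3)).
  assert (Hj := last_le_sum g j Hg).
  assert (X := Hg j).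
  assert (Hc : 0 < c) by nra.
  destruct (record_value_bound 0 (g j) (sum_f_R0 g j) 0) as (A1 & A2 & A3);
    try (simpl; lra).
  { intros i Hi. replace i with 1%nat by lia. simpl; lra. }
  exists j, 0. repeat split; try (simpl; lra); try assumption.
  intros i Hi. destruct (Nat.eq_dec i j) as [->|]; [lra|].
  assert (Y := H3 i ltac:(lia)); lra.
Qed.

(** As [g j < Lam], a further record exists, and its sum is at most [c * g j <= c * (s - T)], where
    [s] is the sum up to [g j]. The last inequality of [record_value_bound] makes this a growth
    bound over [s], so [s] becomes the new [T]. *)
Lemma record_bound_S (k : nat) :
  lam * pol k c < Lam -> record_bound k -> record_bound (S k).
Proof.
  intros Hk (j & T & H1 & H2 & H3 & H4 & H5 & H6 & H7).
  destruct (CR_next_record j) as (j' & J1 & J2 & J3 & J4); [lra|exact H2|].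
  assert (X := Hg j). assert (X' := Hg j').
  assert (Hs' := last_le_sum g j' Hg).
  assert (Hs := last_le_sum g j Hg).
  assert (Hc : 0 < c) by nra.
  assert (HS := sum_f_R0_lt g j j' Hg J1).
  destruct (record_value_bound k (g j) (sum_f_R0 g j) T) as (A1 & A2 & A3);
    try assumption; try lra.
  { intros i Hi; apply H6; lia. }
  assert (P := H6 (S k) ltac:(lia)).
  assert (P2 := H6 (S (S k)) ltac:(lia)).
  assert (E1 : sum_f_R0 g j' * qpol (S k) c <= sum_f_R0 g j * qpol (S (S k)) c).
  { apply Rle_trans with (2 := A3). apply Rmult_le_compat_r; nra. }
  assert (E2 : sum_f_R0 g j' <= c * lam * qpol (S (S k)) c).
  { apply Rmult_le_reg_r with (qpol (S k) c); [exact P|].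
    apply Rle_trans with (1 := E1). nra. }
  destruct (record_value_bound (S k) (g j') (sum_f_R0 g j') (sum_f_R0 g j))
    as (B1 & B2 & B3); try assumption; try lra.
  exists j', (sum_f_R0 g j). repeat split; try assumption; lra.
Qed.

End LowerBound.

(** Suppose the ratio is at most [1 + 2 c] with [c < a]. Records 0 to [n] stay below
    [lam * pol n a = Lam], so record [n + 1] exists. As [qpol (n+4) a <= 0], also
    [qpol (n+4) c <= 0], that is [pol (n+1) c <= pol n c], so record [n + 1] is again below [Lam]. A
    record [n + 2] would then exist and force [qpol (n+4) c > 0]. *)
Lemma CR_ge (lam Lam a : R) (n : nat) (g : nat -> R) :
  0 < lam <= Lam -> strategy g ->
  in_bracket n a -> pol n a = Lam / lam ->
  Rbar_le (Finite (1 + 2 * a)) (CR lam Lam g).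
Proof.
  intros Hl Hg Hbr Hroot.
  apply Rbar_not_lt_le; intros Hlt.
  (* A finite ratio [r] is [1 + 2 c] for [c = (r - 1) / 2]; under [m_infty] any [c < a] will do. *)
  assert (Hc : exists c, c < a /\ Rbar_le (CR lam Lam g) (Finite (1 + 2 * c))).
  { destruct (CR lam Lam g) as [r| |].
    - exists ((r - 1) / 2). simpl in *. split; lra.
    - easy.
    - exists (a - 1). simpl; split; [lra|exact I]. }
  destruct Hc as (c & Hca & Hcr).
  assert (HLam : Lam = lam * pol n a) by (rewrite Hroot; field; lra).
  assert (Hmono := qpol_nondecreasing n a Hbr).
  destruct Hbr as (Ha & Hpos & H3 & H4).
  assert (Hsmall : forall k, (k <= n)%nat -> record_bound lam c g k ->
    0 < c /\ lam * pol k c < Lam).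
  { intros k Hk (j & T & R1 & R2 & R3 & R4 & R5 & R6 & R7).
    assert (Hc0 : 0 < c).
    { assert (Y := R6 2%nat ltac:(lia)). simpl in Y. lra. }
    split; [exact Hc0|].
    assert (X := pol_lt_mono c a k ltac:(lra) R6).
    assert (Y : pol k a <= pol n a) by (rewrite !pol_qpol; apply Hmono; lia).
    rewrite HLam. nra. }
  assert (Hrec : forall k, (k <= S n)%nat -> record_bound lam c g k).
  { induction k as [|k IH]; intros Hk.
    - eapply record_bound_0; eassumption.
    - assert (IHk := IH ltac:(lia)).
      apply (record_bound_S lam Lam); try assumption.
      apply Hsmall; [lia|exact IHk]. }
  destruct (Hsmall n (Nat.le_refl n) (Hrec n ltac:(lia))) as [Hc0 Hn].
  assert (Hneg : (forall i, (1 <= i <= S (S (S n)))%nat -> 0 < qpol i c) ->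
    qpol (S (S (S (S n)))) c <= 0).
  { intros P. apply Rnot_lt_le; intros X.
    assert (0 < qpol (S (S (S (S n)))) a); [|lra].
    apply (qpol_pos_mono c a (S (S (S (S n))))); [lra| |lia].
    intros i Hi. destruct (Nat.eq_dec i (S (S (S (S n))))) as [->|]; [exact X|].
    apply P; lia. }
  assert (Hlast := Hrec (S n) ltac:(lia)).
  assert (Hlast2 := Hlast).
  destruct Hlast2 as (_ & _ & _ & _ & _ & _ & _ & R6 & _).
  specialize (Hneg R6).
  assert (HSn : lam * pol (S n) c < Lam).
  { assert (X : pol (S n) c <= pol n c).
    { rewrite !pol_qpol. rewrite qpol_SS in Hneg. nra. }
    nra. }
  destruct (record_bound_S lam Lam c g Hl Hg Hcr (S n) HSn Hlast)
    as (_ & _ & _ & _ & _ & _ & _ & R6' & _).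
  assert (X := R6' (S (S (S (S n)))) ltac:(lia)). lra.
Qed.

(** By telescoping, each sum before the last round is exactly [a] times the previous entry. Only the
    final step to [Lam] deviates from the recurrence, and the hypothesis with [B] is its condition;
    for [n = 0] it reads [Lam / lam <= B]. *)
Lemma CR_recurrence_le (lam Lam a B : R) (n : nat) (f : nat -> R) :
  0 < lam <= Lam -> 0 < a <= B ->
  (forall i, (1 <= i <= S n)%nat -> 0 < qpol i a) ->
  a * qpol n a + Lam / lam <= B * qpol (S n) a ->
  (forall i, (i < n)%nat -> f i = lam * pol i a) ->
  f n = Lam ->
  Rbar_le (CR lam Lam f) (Finite (1 + 2 * B)).
Proof.
  intros Hl Ha Hpos HB Hf Hfn.
  assert (HLam : Lam = lam * (Lam / lam)) by (field; lra).
  assert (Hsum : forall j, (j < n)%nat -> sum_f_R0 f j = lam * (a * qpol (S j) a)).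
  { intros j Hj. rewrite <- sum_pol, scal_sum. apply sum_eq.
    intros i Hi. rewrite Hf by lia. ring. }
  apply CR_le with n; [lra|lra|lra| |].
  - destruct n as [|n].
    + rewrite Hfn. simpl in HB. nra.
    + rewrite Hf by lia. simpl. nra.
  - intros j Hj.
    rewrite tech5, Hsum by exact Hj.
    assert (Hfj : f j = lam * qpol (S (S j)) a) by (rewrite Hf by lia; rewrite pol_qpol; reflexivity).
    rewrite Hfj.
    destruct (Nat.eq_dec (S j) n) as [E|].
    + rewrite E, Hfn.
      apply Rmult_le_compat_l with (r := lam) in HB; lra.
    + rewrite Hf by lia. rewrite pol_qpol, (qpol_SS (S j)).
      assert (P := Hpos (S (S j)) ltac:(lia)).
      assert (0 < lam * qpol (S (S j)) a) by nra. nra.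
Qed.

(** * Thresholds *)

(** The Taylor polynomial of degree 4 bounds [cos 1.05] strictly below [1/2 = cos (PI / 3)]. *)
Lemma PI_upper : PI < 315 / 100.
Proof.
  apply Rnot_le_lt; intros H.
  assert (H1 : cos (PI / 3) <= cos (105 / 100)) by (apply cos_decr_1; lra).
  rewrite cos_PI3 in H1.
  destruct (cos_bound (105 / 100) 0) as [_ H2]; [lra|lra|].
  unfold cos_approx, cos_term in H2. simpl in H2. lra.
Qed.

(** Follows from [cos x = 1 - 2 sin^2 (x/2)] and [|sin y| < y] for positive [y]. *)
Lemma cos_ge_quadratic (x : R) : 0 < x -> 1 - x * x / 2 <= cos x.
Proof.
  intros Hx. replace x with (2 * (x / 2)) at 3 by field.
  rewrite cos_2a_sin.
  assert (H := sin_lt_x (x / 2) ltac:(lra)).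
  destruct (Rle_dec 0 (sin (x / 2))) as [P|P]; [nra|].
  assert (H2 : - sin (x / 2) < x / 2); [|nra].
  destruct (Rle_dec x 2) as [L|L].
  - assert (0 < sin (x / 2)); [|lra].
    assert (HP := PI2_3_2).
    apply sin_gt_0; [lra|]. unfold PI2 in *. lra.
  - assert (B := SIN_bound (x / 2)). lra.
Qed.

Lemma bernoulli (x : R) (n : nat) : 0 <= x <= 1 -> 1 - INR n * x <= (1 - x) ^ n.
Proof.
  intros Hx; induction n as [|n IH]; [simpl; lra|].
  rewrite S_INR. simpl. assert (P := pos_INR n).
  apply Rle_trans with ((1 - x) * (1 - INR n * x)); [nra|].
  apply Rmult_le_compat_l; lra.
Qed.

Lemma angle3_bounds (n : nat) : 0 < PI / (INR n + 3) <= PI / 3.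
Proof.
  assert (P := PI_RGT_0). assert (X := pos_INR n).
  split; [apply Rdiv_lt_0_compat; lra|].
  apply Rmult_le_compat_l; [lra|]. apply Rinv_le_contravar; lra.
Qed.

Lemma cos_angle3_bounds (n : nat) : 1 / 2 <= cos (PI / (INR n + 3)) < 1.
Proof.
  destruct (angle3_bounds n) as [H1 H2]. assert (P := PI_RGT_0).
  split.
  - rewrite <- cos_PI3. apply cos_decr_1; lra.
  - rewrite <- cos_0. apply cos_decreasing_1; lra.
Qed.

Lemma threshold_0 : threshold 0 = 1.
Proof.
  unfold threshold. replace (INR 0 + 3) with 3 by (simpl; ring).
  rewrite cos_PI3. field.
Qed.

(** The cut-off between the exact and the approximate case is the first value of [rho] with index
    4. *)
Lemma threshold_4 : threshold 4 = 32 * cos (PI / 7) ^ 5.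
Proof.
  unfold threshold. replace (INR 4 + 3) with 7 by (simpl; ring). ring.
Qed.

Lemma threshold_upper (n : nat) : threshold n < 2 ^ (S n).
Proof.
  destruct (cos_angle3_bounds n) as [H1 H2]. unfold threshold.
  rewrite Rpow_mult_distr.
  assert (H : cos (PI / (INR n + 3)) ^ (S n) < 1).
  { replace 1 with (1 ^ (S n)) by apply pow1.
    rewrite <- !Rpower_pow by lra.
    apply Rlt_Rpower_l; [apply lt_0_INR; lia|lra]. }
  assert (X : 0 < 2 ^ (S n)) by (apply pow_lt; lra).
  nra.
Qed.

(* Bernoulli's inequality suffices only for [n >= 5]. *)
Lemma cos_angle3_pow (n : nat) : / 2 <= cos (PI / (INR n + 3)) ^ (S n).
Proof.
  assert (HP := PI_upper). assert (P0 := PI_RGT_0).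
  assert (Hq : forall x u, 0 < x -> x <= u -> 1 - u * u / 2 <= cos x).
  { intros x u Hx Hu. apply Rle_trans with (2 := cos_ge_quadratic x Hx). nra. }
  assert (Hp : forall k c x, 0 <= c <= x -> c ^ k <= x ^ k)
    by (intros; apply pow_incr; assumption).
  destruct (Nat.le_gt_cases 5 n) as [Hn|Hn].
  - apply le_INR in Hn. simpl in Hn.
    set (N := INR n + 3).
    assert (HN : 8 <= N) by (unfold N; lra).
    set (u := (315 / 100 / N) * (315 / 100 / N) / 2).
    assert (Hu : 0 <= u <= 1 /\ (N - 2) * u <= / 2).
    (* [99225 / 20000] is [3.15^2 / 2], so [u] bounds [1 - cos (PI / N)] from above. *)
    { assert (E : u = 99225 / 20000 / (N * N)) by (unfold u; field; lra).
      assert (X : N * N * / (N * N) = 1) by (field; lra).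
      assert (Y : 0 < / (N * N)) by (apply Rinv_0_lt_compat; nra).
      rewrite E. unfold Rdiv. set (y := / (N * N)) in *.
      repeat split; [nra|nra|].
      apply Rle_trans with (/ 2 * (N * N * y)); [|rewrite X; lra].
      assert (99225 / 20000 * (N - 2) <= / 2 * (N * N)) by nra. nra. }
    destruct Hu as [Hu1 Hu2].
    apply Rle_trans with (1 - INR (S n) * u).
    { rewrite S_INR. replace (INR n + 1) with (N - 2) by (unfold N; ring). lra. }
    apply Rle_trans with (1 := bernoulli u (S n) Hu1).
    apply Hp. split; [lra|].
    apply Hq; [apply Rdiv_lt_0_compat; lra|].
    apply Rmult_le_compat_r; [|lra]. left; apply Rinv_0_lt_compat; lra.
  - assert (Hb : forall m c, 1 - (315 / 100 / (INR m + 3)) * (315 / 100 / (INR m + 3)) / 2 = c ->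
      0 <= c -> c ^ (S m) <= cos (PI / (INR m + 3)) ^ (S m)).
    { intros m c Hc Hc0. apply Hp. split; [exact Hc0|]. rewrite <- Hc.
      assert (X := pos_INR m).
      apply Hq; [apply Rdiv_lt_0_compat; lra|].
      apply Rmult_le_compat_r; [|lra]. left; apply Rinv_0_lt_compat; lra. }
    assert (Hcase : n = 0%nat \/ n = 1%nat \/ n = 2%nat \/ n = 3%nat \/ n = 4%nat) by lia.
    (* For [n = 0] and [n = 1] the claim is an equality, so exact cosines are used there. *)
    destruct Hcase as [->|[->|[->|[->| ->]]]].
    + replace (INR 0 + 3) with 3 by (simpl; ring). rewrite cos_PI3. lra.
    + replace (INR 1 + 3) with 4 by (simpl; ring). rewrite cos_PI4.
      simpl. assert (X := sqrt_sqrt 2 ltac:(lra)).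
      assert (Y := sqrt_lt_R0 2 ltac:(lra)).
      apply Req_le. rewrite <- X at 1. field. lra.
    + eapply Rle_trans; [|apply Hb; [reflexivity|simpl; lra]]. simpl. lra.
    + replace (INR 3 + 3) with 6 by (simpl; ring). rewrite cos_PI6.
      assert (X := sqrt_sqrt 3 ltac:(lra)). set (r := sqrt 3) in *.
      replace ((r / 2) ^ 4) with ((r * r) * (r * r) / 16) by (simpl; field).
      rewrite X. lra.
    + eapply Rle_trans; [|apply Hb; [reflexivity|simpl; lra]]. simpl. lra.
Qed.

Lemma threshold_lower (n : nat) : 2 ^ n <= threshold n.
Proof.
  unfold threshold. rewrite Rpow_mult_distr.
  assert (H := cos_angle3_pow n).
  assert (X : 0 < 2 ^ n) by (apply pow_lt; lra).
  rewrite <- (tech_pow_Rmult 2 n). nra.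
Qed.

(** The powers of two separate consecutive thresholds:
    [threshold n < 2^(n+1) <= threshold (n+1)]. *)
Lemma threshold_increasing (m n : nat) : (m <= n)%nat -> threshold m <= threshold n.
Proof.
  induction 1 as [|n Hn IH]; [lra|].
  assert (H1 := threshold_upper n). assert (H2 := threshold_lower (S n)). lra.
Qed.

Lemma floor_log2 (rho : R) :
  1 <= rho ->
  exists N : nat, IZR (Int_part (ln rho / ln 2)) = INR N /\
    2 ^ N <= rho < 2 ^ (S N).
Proof.
  intros Hr.
  assert (L2 : 0 < ln 2) by (rewrite <- ln_1; apply ln_increasing; lra).
  assert (Hl : 0 <= ln rho / ln 2).
  { apply Rdiv_le_0_compat; [|exact L2].
    rewrite <- ln_1. apply ln_le; lra. }
  destruct (base_Int_part (ln rho / ln 2)) as [B1 B2].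
  set (z := Int_part (ln rho / ln 2)) in *.
  assert (Hz : (0 <= z)%Z).
  { apply Z.lt_succ_r, lt_IZR. rewrite succ_IZR. lra. }
  exists (Z.to_nat z).
  assert (E : IZR z = INR (Z.to_nat z)) by (rewrite INR_IZR_INZ, Z2Nat.id; auto).
  split; [exact E|]. rewrite E in B1, B2. set (N := Z.to_nat z) in *.
  assert (Hx : ln rho = ln rho / ln 2 * ln 2) by (field; lra).
  rewrite <- !Rpower_pow by lra. unfold Rpower. rewrite S_INR.
  split.
  - rewrite <- (exp_ln rho) by lra.
    destruct (Rle_lt_or_eq_dec _ _ B1) as [L|L].
    + left. apply exp_increasing. nra.
    + right. f_equal. rewrite L. lra.
  - rewrite <- (exp_ln rho) at 1 by lra. apply exp_increasing. nra.
Qed.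

(** Identifies the test by which the algorithm lowers its index; logarithms to the base
    [2 cos (PI / (n+3))] require that base to exceed 1. *)
Lemma log_lt_threshold (rho : R) (n : nat) :
  0 < rho -> 1 < 2 * cos (PI / (INR n + 3)) ->
  (ln rho / ln (2 * cos (PI / (INR n + 3))) < INR n + 1 <-> rho < threshold n).
Proof.
  intros Hr Hg. unfold threshold.
  set (g := 2 * cos (PI / (INR n + 3))) in *.
  assert (L : 0 < ln g) by (rewrite <- ln_1; apply ln_increasing; lra).
  assert (E : ln (g ^ S n) = (INR n + 1) * ln g).
  { rewrite <- Rpower_pow by lra. unfold Rpower. rewrite ln_exp, S_INR. reflexivity. }
  assert (Hx : ln rho = ln rho / ln g * ln g) by (field; lra).
  assert (Hp : 0 < g ^ S n) by (apply pow_lt; lra).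
  split; intros H.
  - apply ln_lt_inv; [exact Hr|exact Hp|]. rewrite E. nra.
  - apply Rmult_lt_reg_r with (ln g); [exact L|]. rewrite <- Hx, <- E.
    apply ln_increasing; assumption.
Qed.

Lemma gamma_gt_1 (n : nat) : (1 <= n)%nat -> 1 < 2 * cos (PI / (INR n + 3)).
Proof.
  intros Hn. apply (le_INR 1) in Hn. simpl in Hn. assert (P := PI_RGT_0).
  assert (H : cos (PI / 3) < cos (PI / (INR n + 3))).
  { destruct (angle3_bounds n). apply cos_decreasing_1; try lra.
    apply Rmult_lt_compat_l; [lra|]. apply Rinv_lt_contravar; lra. }
  rewrite cos_PI3 in H. lra.
Qed.

(** * Existence of the root and width of the bracket *)

Lemma continuity_pol (n : nat) : continuity (pol n).
Proof.
  assert (H : forall k, continuity (qpol k) /\ continuity (qpol (S k))).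
  { induction k as [|k [H1 H2]].
    - split; apply continuity_const; intros x y; reflexivity.
    - split; [exact H2|].
      change (continuity (mult_fct id (minus_fct (qpol (S k)) (qpol k)))).
      apply continuity_mult; [apply derivable_continuous, derivable_id|].
      apply continuity_minus; assumption. }
  intros x. apply continuity_pt_ext with (qpol (S (S n))).
  - intros y; symmetry; apply pol_qpol.
  - apply (H (S (S n))).
Qed.

Lemma alpha_increasing (n : nat) : alpha (S n) < alpha (S (S n)).
Proof.
  unfold alpha.
  assert (P := PI_RGT_0). assert (Xn := pos_INR (S n)).
  assert (A := angle_bounds (S n) ltac:(lia)).
  assert (B := angle_bounds (S (S n)) ltac:(lia)).
  assert (H : cos (PI / (INR (S n) + 2)) < cos (PI / (INR (S (S n)) + 2))).
  { apply cos_decreasing_1; try lra.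
    apply Rmult_lt_compat_l; [lra|]. rewrite (S_INR (S n)).
    apply Rinv_lt_contravar; nra. }
  assert (C := cos_angle_pos (S n) ltac:(lia)). nra.
Qed.

Lemma pol_root_exists (n : nat) (rho : R) :
  threshold n <= rho < threshold (S n) ->
  exists a, alpha (S n) <= a <= alpha (S (S n)) /\ pol n a = rho.
Proof.
  intros Hr.
  assert (E1 := pol_alpha_lower n). assert (E2 := pol_alpha_upper n).
  destruct (IVT_cor (fun x => pol n x - rho) (alpha (S n)) (alpha (S (S n))))
    as (a & Ha & Ea).
  - apply continuity_minus; [apply continuity_pol|].
    apply continuity_const; intros x y; reflexivity.
  - left; apply alpha_increasing.
  - rewrite E1, E2. nra.
  - exists a; split; [exact Ha|lra].
Qed.

(** With [u = PI / (n+4)] and [v = PI / (n+3)], the gap is [4 sin (v+u) sin (v-u) <= 4 (v^2 - u^2)].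
    The constant is [7^3 / 2]: the cube matches the factor 7 in the test on [eps], and the half
    compensates for the ratio [1 + 2 a] doubling every error in [a]. *)
Lemma alpha_gap (n : nat) :
  (4 <= n)%nat ->
  alpha (S (S n)) - alpha (S n) <= 343 / 2 / (INR n + 4) ^ 3.
Proof.
  intros Hn. apply le_INR in Hn. simpl in Hn.
  unfold alpha. rewrite !S_INR.
  replace (INR n + 1 + 1 + 2) with (INR n + 4) by ring.
  replace (INR n + 1 + 2) with (INR n + 3) by ring.
  set (N := INR n + 4). replace (INR n + 3) with (N - 1) by (unfold N; ring).
  assert (HN : 8 <= N) by (unfold N; lra).
  assert (P := PI_RGT_0). assert (PU := PI_upper).
  set (u := PI / N). set (v := PI / (N - 1)).
  assert (Hu : 0 < u) by (apply Rdiv_lt_0_compat; lra).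
  assert (Hv : u < v).
  { apply Rmult_lt_compat_l; [lra|]. apply Rinv_lt_contravar; nra. }
  assert (Hv1 : v <= 315 / 700).
  { unfold v. apply Rmult_le_reg_r with (N - 1); [lra|].
    unfold Rdiv at 1. rewrite Rmult_assoc, Rinv_l; lra. }
  assert (E : cos u * cos u - cos v * cos v = sin (v + u) * sin (v - u)).
  { rewrite sin_plus, sin_minus.
    assert (Eu := sin2_cos2 u). assert (Ev := sin2_cos2 v). unfold Rsqr in *.
    replace ((sin v * cos u + cos v * sin u) * (sin v * cos u - cos v * sin u))
      with ((sin v * sin v) * (cos u * cos u) - (cos v * cos v) * (sin u * sin u)) by ring.
    replace (sin v * sin v) with (1 - cos v * cos v) by lra.
    replace (sin u * sin u) with (1 - cos u * cos u) by lra. ring. }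
  assert (S1 := sin_lt_x (v + u) ltac:(lra)).
  assert (S2 := sin_lt_x (v - u) ltac:(lra)).
  assert (PP := PI2_3_2). unfold PI2 in PP.
  assert (S3 : 0 < sin (v + u)) by (apply sin_gt_0; lra).
  assert (S4 : 0 < sin (v - u)) by (apply sin_gt_0; lra).
  assert (G : cos u * cos u - cos v * cos v <= (v + u) * (v - u)) by (rewrite E; nra).
  apply Rle_trans with (4 * ((v + u) * (v - u))); [lra|].
  assert (F : (v + u) * (v - u) = PI * PI * ((2 * N - 1) / (N * N * ((N - 1) * (N - 1)))))
    by (unfold u, v; field; lra).
  rewrite F.
  assert (W : 0 < N * N * ((N - 1) * (N - 1))) by (apply Rmult_lt_0_compat; nra).
  (* Here [4 * PI^2 < 40], since [3.15^2 < 10]. *)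
  apply Rle_trans with (40 * ((2 * N - 1) / (N * N * ((N - 1) * (N - 1))))).
  { rewrite <- Rmult_assoc. apply Rmult_le_compat_r; [|nra].
    apply Rdiv_le_0_compat; lra. }
  apply Rmult_le_reg_r with (N * N * N * ((N - 1) * (N - 1))).
  { replace (N * N * N * ((N - 1) * (N - 1))) with (N * (N * N * ((N - 1) * (N - 1)))) by ring.
    nra. }
  replace (40 * ((2 * N - 1) / (N * N * ((N - 1) * (N - 1)))) * (N * N * N * ((N - 1) * (N - 1))))
    with (40 * (2 * N - 1) * N) by (field; lra).
  replace (343 / 2 / N ^ 3 * (N * N * N * ((N - 1) * (N - 1))))
    with (343 / 2 * ((N - 1) * (N - 1))) by (field; lra).
  nra.
Qed.

(** Cubing [7 eps^(-1/3) <= n + 4] gives [343 / eps <= (n+4)^3]. *)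
Lemma eps_large (eps : R) (n : nat) :
  0 < eps -> 7 * Rpower eps (-1 / 3) - 4 <= INR n -> 343 / (INR n + 4) ^ 3 <= eps.
Proof.
  intros He Hn.
  set (r := Rpower eps (-1 / 3)) in *.
  assert (Hr : 0 < r) by apply exp_pos.
  assert (E : r ^ 3 * eps = 1).
  { rewrite <- Rpower_pow by exact Hr. unfold r. rewrite Rpower_mult.
    replace (-1 / 3 * INR 3) with (- (1)) by (simpl; field).
    rewrite Rpower_Ropp, Rpower_1 by exact He. field. lra. }
  assert (H : (7 * r) ^ 3 <= (INR n + 4) ^ 3) by (apply pow_incr; lra).
  assert (X := pos_INR n).
  assert (Y : 0 < (INR n + 4) ^ 3) by (apply pow_lt; lra).
  apply Rmult_le_reg_r with ((INR n + 4) ^ 3); [exact Y|].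
  unfold Rdiv. rewrite Rmult_assoc, Rinv_l by lra.
  replace ((7 * r) ^ 3) with (343 * r ^ 3) in H by ring. nra.
Qed.

(** * The recurrent strategies *)

Definition has_entries (lam Lam a : R) (n : nat) (f : nat -> R) : Prop :=
  (forall i, (i < n)%nat -> f i = lam * pol i a) /\
  (forall i, (n <= i)%nat -> f i = Lam).

Lemma has_entries_strategy (lam Lam a : R) (n : nat) (f : nat -> R) :
  0 < lam <= Lam -> in_bracket n a -> has_entries lam Lam a n f -> strategy f.
Proof.
  intros Hl (_ & Hpos & _) [F1 F2] i.
  destruct (Nat.lt_ge_cases i n) as [Hi|Hi].
  - rewrite (F1 i Hi), pol_qpol.
    assert (P := Hpos (S (S i)) ltac:(lia)). nra.
  - rewrite (F2 i Hi). lra.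
Qed.

(** The condition on the last round, with [pol n a = a * (qpol (n+1) a - qpol n a)] substituted: the
    defect of [pol n a] is paid for by raising [a] to [B]. *)
Lemma CR_entries_le (lam Lam a B : R) (n : nat) (f : nat -> R) :
  0 < lam <= Lam -> in_bracket n a -> a <= B ->
  Lam / lam - pol n a <= (B - a) * qpol (S n) a ->
  has_entries lam Lam a n f ->
  Rbar_le (CR lam Lam f) (Finite (1 + 2 * B)).
Proof.
  intros Hl (Ha & Hpos & _) HaB HB [F1 F2].
  apply CR_recurrence_le with a n; try assumption; [lra| | |].
  - intros i Hi; apply Hpos; lia.
  - rewrite pol_qpol, qpol_SS in HB. lra.
  - apply F2; lia.
Qed.

Lemma entries_optimal (lam Lam a : R) (n : nat) (f : nat -> R) :
  0 < lam <= Lam -> in_bracket n a -> pol n a = Lam / lam ->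
  has_entries lam Lam a n f -> optimal lam Lam f.
Proof.
  intros Hl Hbr Hroot HF. split.
  - eapply has_entries_strategy; eassumption.
  - intros g Hg. apply Rbar_le_trans with (Finite (1 + 2 * a)).
    + apply CR_entries_le with a n; try assumption; lra.
    + apply CR_ge with n; assumption.
Qed.

(** The exact root [b] yields the optimum, whose ratio is at least [1 + 2 b]. It remains to bound
    the ratio for [a] by [1 + 2 b + eps], separately for [pol n a] above and below [rho]. *)
Lemma entries_near_optimal (lam Lam eps a : R) (n : nat) (f : nat -> R) :
  0 < lam <= Lam -> 0 < eps -> (4 <= n)%nat ->
  threshold n <= Lam / lam < threshold (S n) ->
  alpha (S n) <= a <= alpha (S (S n)) ->
  Rabs (pol n a - Lam / lam) < eps \/
  a = alpha (S (S n)) /\ 7 * Rpower eps (-1 / 3) - 4 <= INR n ->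
  has_entries lam Lam a n f ->
  exists f_opt, optimal lam Lam f_opt /\
    Rbar_le (CR lam Lam f) (Rbar_plus (CR lam Lam f_opt) (Finite eps)).
Proof.
  intros Hl He Hn Hr Ha Happ HF.
  destruct (pol_root_exists n (Lam / lam) Hr) as (b & Hb & Eb).
  assert (Bb := in_bracket_alpha n b Hb).
  assert (Ba := in_bracket_alpha n a Ha).
  set (fo := fun i => if Nat.ltb i n then lam * pol i b else Lam).
  assert (Ho : optimal lam Lam fo).
  { apply entries_optimal with b n; try assumption.
    split; intros i Hi; unfold fo.
    - apply Nat.ltb_lt in Hi; rewrite Hi; reflexivity.
    - apply Nat.ltb_ge in Hi; rewrite Hi; reflexivity. }
  exists fo; split; [exact Ho|].
  assert (Hge := CR_ge lam Lam b n fo Hl (proj1 Ho) Bb Eb).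
  assert (Hgoal : Rbar_le (CR lam Lam f) (Finite (1 + 2 * b + eps)));
    [|destruct (CR lam Lam fo) as [r| |]; simpl in *;
      [|destruct (CR lam Lam f); exact I|easy];
      apply Rbar_le_trans with (1 := Hgoal); simpl; lra].
  assert (Htl := threshold_lower n).
  assert (H16 : 16 <= 2 ^ n).
  { replace 16 with (2 ^ 4) by (simpl; ring). apply Rle_pow; [lra|exact Hn]. }
  assert (Hq : 1 <= qpol (S n) a) by (apply (qpol_nondecreasing n a Ba 1); lia).
  assert (Hb4 : b <= 4).
  { apply Rle_trans with (1 := proj2 Hb). unfold alpha.
    assert (X := COS_bound (PI / (INR (S (S n)) + 2))). nra. }
  destruct (Rle_dec (Lam / lam) (pol n a)) as [Hle|Hgt].
  - (* Overshooting [rho] costs [2 (a - b)]. *)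
    assert (Hab : a - b <= eps / 2).
    { destruct Happ as [Happ|[-> Hlarge]].
      - destruct (Rle_dec a b) as [|Hba]; [lra|].
        destruct Bb as (Hb0 & Hbpos & _).
        assert (G := qpol_growth b a n ltac:(lra) Hbpos).
        rewrite <- !pol_qpol in G. rewrite Eb in G.
        apply Rabs_def2 in Happ.
        assert (K : (Lam / lam) * (a - b) <= eps * b) by nra.
        (* Uses [rho >= 2^n >= 16] and [b <= 4]. *)
        assert (16 * (a - b) <= eps * 4) by nra. lra.
      - assert (G := alpha_gap n Hn).
        assert (L := eps_large eps n He Hlarge). lra. }
    apply Rbar_le_trans with (Finite (1 + 2 * a)); [|simpl; lra].
    apply CR_entries_le with a n; try assumption; lra.
  - assert (Hab : a < b).
    { apply Rnot_le_lt; intros Hba. apply Hgt. rewrite <- Eb.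
      destruct (Rle_lt_or_eq_dec _ _ Hba) as [L|E]; [|rewrite E; lra].
      destruct Bb as (Hb0 & Hbpos & _).
      left; apply pol_lt_mono; [lra|exact Hbpos]. }
    destruct Happ as [Happ|[E _]].
    (* The upper end of the bracket cannot undershoot: its value is [threshold (n+1) > rho]. *)
    2: { rewrite E, pol_alpha_upper in Hgt. lra. }
    apply Rabs_def2 in Happ.
    set (d := (Lam / lam - pol n a) / qpol (S n) a).
    (* Undershooting costs [2 d], where [d <= eps / 2] since the
       penultimate entry is at least [2]. *)
    assert (Hq2 : 2 <= qpol (S n) a).
    { apply Rle_trans with (qpol 2 a); [|apply (qpol_nondecreasing n a Ba); lia].
      simpl. apply Rle_trans with (alpha (S n)); [|lra].
      replace (1 * 1) with 1 by ring. unfold alpha.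
      assert (C : cos (PI / 4) <= cos (PI / (INR (S n) + 2))).
      { apply le_INR in Hn. simpl in Hn. assert (P := PI_RGT_0).
        assert (X := angle_bounds (S n) ltac:(lia)).
        apply cos_decr_1; try lra. apply Rmult_le_compat_l; [lra|].
        apply Rinv_le_contravar; rewrite ?S_INR; lra. }
      rewrite cos_PI4 in C.
      assert (X := sqrt_sqrt 2 ltac:(lra)).
      assert (Y := sqrt_lt_R0 2 ltac:(lra)).
      assert (Z : 1 / sqrt 2 * (1 / sqrt 2) = / (sqrt 2 * sqrt 2)) by (field; lra).
      rewrite X in Z.
      assert (W : 0 < 1 / sqrt 2) by (apply Rdiv_lt_0_compat; lra).
      nra. }
    assert (Hd : 0 < d <= eps / 2).
    { split; [apply Rdiv_lt_0_compat; lra|].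
      apply Rmult_le_reg_r with (qpol (S n) a); [lra|].
      unfold d, Rdiv. rewrite Rmult_assoc, Rinv_l by lra. nra. }
    apply Rbar_le_trans with (Finite (1 + 2 * (a + d))); [|simpl; lra].
    apply CR_entries_le with a n; try assumption; [lra|].
    apply Req_le. unfold d. field. lra.
Qed.

(** * Solution by radicals *)

Lemma root_val_spec (k : nat) (x : R) :
  (1 <= k)%nat -> 0 < x ->
  0 < unop_val (URoot k) x /\ unop_val (URoot k) x ^ k = x.
Proof.
  intros Hk Hx. simpl. unfold rpow.
  destruct (Rlt_dec 0 x) as [_|]; [|lra].
  split; [apply exp_pos|].
  rewrite <- Rpower_pow by apply exp_pos.
  rewrite Rpower_mult, Rinv_l; [apply Rpower_1; exact Hx|].
  apply not_0_INR; lia.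
Qed.

Lemma cube_inj (x y : R) : 0 < x -> 0 < y -> x ^ 3 = y ^ 3 -> x = y.
Proof.
  intros Hx Hy H.
  assert (E : (x - y) * (x * x + x * y + y * y) = 0) by (simpl in H; lra).
  apply Rmult_integral in E as [E|E]; [lra|nra].
Qed.

Lemma radical_1 (rho : R) :
  0 < rho ->
  0 < (1 + unop_val (URoot 2) (1 + 4 * rho)) / 2 /\
  pol 1 ((1 + unop_val (URoot 2) (1 + 4 * rho)) / 2) = rho.
Proof.
  intros Hr.
  destruct (root_val_spec 2 (1 + 4 * rho)) as [H1 H2]; [lia|lra|].
  set (r := unop_val (URoot 2) (1 + 4 * rho)) in *.
  simpl in H2 |- *. split; [lra|]. nra.
Qed.

(** The cube roots [u] and [v] satisfy [(u v)^3 = q^2 - d^2 = (4/9)^3]. Therefore [u v = 4/9] and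
    [u + v] solves the depressed cubic. *)
Lemma radical_2 (rho q d : R) :
  0 < rho ->
  q = (rho + 16 / 27) / 2 ->
  d = unop_val (URoot 2) (q * q - 64 / 729) ->
  0 < 2 / 3 + unop_val (URoot 3) (q + d) + unop_val (URoot 3) (q - d) /\
  pol 2 (2 / 3 + unop_val (URoot 3) (q + d) + unop_val (URoot 3) (q - d)) = rho.
Proof.
  intros Hr Hq Hd.
  destruct (root_val_spec 2 (q * q - 64 / 729)) as [D1 D2]; [lia|nra|].
  rewrite <- Hd in D1, D2. simpl in D2.
  (* Keeps the second radicand positive; a root of a nonpositive number would take the default value
     0. *)
  assert (Hqd : d < q) by nra.
  destruct (root_val_spec 3 (q + d)) as [U1 U2]; [lia|lra|].
  destruct (root_val_spec 3 (q - d)) as [V1 V2]; [lia|lra|].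
  set (u := unop_val (URoot 3) (q + d)) in *.
  set (v := unop_val (URoot 3) (q - d)) in *.
  assert (E : u * v = 4 / 9).
  { apply cube_inj; [nra|lra|]. rewrite Rpow_mult_distr, U2, V2. simpl; nra. }
  split; [lra|].
  assert (C : (u + v) ^ 3 = 2 * q + 4 / 3 * (u + v)).
  { replace ((u + v) ^ 3) with (u ^ 3 + v ^ 3 + 3 * (u * v) * (u + v)) by ring.
    rewrite U2, V2, E. field. }
  set (y := u + v) in *.
  replace (2 / 3 + u + v) with (y + 2 / 3) by (unfold y; ring).
  replace (pol 2 (y + 2 / 3)) with (y ^ 3 - 4 / 3 * y - 16 / 27) by (simpl; field).
  rewrite C, Hq. field.
Qed.

(** The resolvent places [m] strictly between [-5/8] and 0. So [s] is a genuine square root, [c] is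
    negative, and the final quadratic has a positive root; squaring that quadratic equation recovers
    the quartic. *)
Lemma radical_3 (rho P q d m s b c : R) :
  1 < rho ->
  P = (rho - 1 / 12) / 3 ->
  q = (19 * rho / 24 - 1 / 108) / 2 ->
  d = unop_val (URoot 2) (q * q + P * P * P) ->
  m = 1 / 6 + unop_val (URoot 3) (d - q) - unop_val (URoot 3) (d + q) ->
  s = unop_val (URoot 2) (5 / 4 + 2 * m) ->
  b = 3 / 2 + s ->
  c = m + 3 * m / (2 * s) ->
  0 < (b + unop_val (URoot 2) (b * b - 4 * c)) / 2 /\
  pol 3 ((b + unop_val (URoot 2) (b * b - 4 * c)) / 2) = rho.
Proof.
  intros Hr HP Hq Hd Hm Hs Hb Hc.
  assert (P0 : 0 < P) by lra. assert (q0 : 0 < q) by lra.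
  assert (P3 : 0 < P * P * P) by (repeat apply Rmult_lt_0_compat; exact P0).
  destruct (root_val_spec 2 (q * q + P * P * P)) as [D1 D2]; [lia|nra|].
  rewrite <- Hd in D1, D2. simpl in D2.
  assert (Hqd : q < d) by nra.
  destruct (root_val_spec 3 (d - q)) as [U1 U2]; [lia|lra|].
  destruct (root_val_spec 3 (d + q)) as [V1 V2]; [lia|lra|].
  set (u := unop_val (URoot 3) (d - q)) in *.
  set (v := unop_val (URoot 3) (d + q)) in *.
  assert (E : u * v = P).
  { apply cube_inj; [nra|lra|]. rewrite Rpow_mult_distr, U2, V2. simpl; nra. }
  assert (C : (u - v) ^ 3 = - 2 * q - 3 * P * (u - v)).
  { replace ((u - v) ^ 3) with (u ^ 3 - v ^ 3 - 3 * (u * v) * (u - v)) by ring.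
    rewrite U2, V2, E. ring. }
  assert (Hz : u - v = m - 1 / 6) by lra.
  rewrite Hz in C.
  (* The cubic resolvent, multiplied by 8. *)
  assert (Res : 8 * m ^ 3 - 4 * m ^ 2 + 8 * m * rho + 5 * rho = 0)
    by (rewrite HP, Hq in C; simpl in C |- *; lra).
  assert (M0 : m < 0).
  { apply Rnot_le_lt; intros X. simpl in Res.
    assert (0 <= m * (8 * (m * m) - 4 * m + 8 * rho)) by (apply Rmult_le_pos; nra).
    lra. }
  assert (M1 : 0 < 5 / 4 + 2 * m).
  { apply Rnot_le_lt; intros X. simpl in Res.
    assert (0 < m * m) by nra.
    assert ((8 * m + 5) * rho <= 0) by nra.
    assert (8 * m * (m * m) <= 0) by nra.
    lra. }
  destruct (root_val_spec 2 (5 / 4 + 2 * m)) as [S1 S2]; [lia|exact M1|].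
  rewrite <- Hs in S1, S2. simpl in S2.
  assert (C0 : c < 0).
  { rewrite Hc. assert (3 * m / (2 * s) < 0); [|lra].
    apply Rdiv_neg_pos; lra. }
  assert (B0 : 0 < b) by lra.
  destruct (root_val_spec 2 (b * b - 4 * c)) as [W1 W2]; [lia|nra|].
  set (w := unop_val (URoot 2) (b * b - 4 * c)) in *. simpl in W2.
  split; [lra|].
  set (x := (b + w) / 2).
  assert (Q : x * x = b * x - c) by (unfold x; nra).
  assert (F : x * x - 3 / 2 * x + m = s * x - 3 * m / (2 * s)).
  { rewrite Q, Hb, Hc. ring. }
  assert (F2 : (x * x - 3 / 2 * x + m) * (x * x - 3 / 2 * x + m) =
    (s * x - 3 * m / (2 * s)) * (s * x - 3 * m / (2 * s))) by (rewrite F; reflexivity).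
  assert (S2' : s * s = 5 / 4 + 2 * m) by lra.
  assert (G : (s * x - 3 * m / (2 * s)) * (s * x - 3 * m / (2 * s)) =
    (s * s) * (x * x) - 3 * m * x + 9 * (m * m) / (4 * (s * s))) by (field; lra).
  rewrite G, S2' in F2.
  (* The resolvent again, now as the condition that completes the right-hand square. *)
  assert (K : 9 * (m * m) / (4 * (5 / 4 + 2 * m)) = m * m + rho).
  { apply Rmult_eq_reg_r with (4 * (5 / 4 + 2 * m)); [|lra].
    unfold Rdiv at 1. rewrite Rmult_assoc, Rinv_l by lra. simpl in Res. lra. }
  rewrite K in F2. simpl. lra.
Qed.

(** As [rho >= 2^n], a positive solution lies beyond 1, 2 or 2.6 for [n] = 1, 2 or 3. There the
    quotient of [pol n x - pol n y] by [x - y] is positive, so two solutions coincide. *)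
Lemma pol_root_unique (n : nat) (rho x y : R) :
  (n <= 3)%nat -> threshold n <= rho ->
  0 < x -> pol n x = rho -> 0 < y -> pol n y = rho -> x = y.
Proof.
  intros Hn Hr Hx Ex Hy Ey.
  assert (T := threshold_lower n).
  destruct n as [|[|[|[|n]]]]; [| | | |lia]; simpl in *.
  - lra.
  - assert (x1 : 1 < x) by nra. assert (y1 : 1 < y) by nra.
    assert (E : (x - y) * (x + y - 1) = 0) by lra.
    apply Rmult_integral in E as [E|E]; lra.
  - assert (L : forall z, 0 < z -> z * (z * (z - 1) - z) = rho -> 2 < z).
    { intros z Hz Ez. apply Rnot_le_lt; intros X.
      assert (0 <= z * z * (2 - z)) by (apply Rmult_le_pos; nra). lra. }
    apply L in Ex as x2; [|exact Hx]. apply L in Ey as y2; [|exact Hy].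
    assert (E : (x - y) * (x * x + x * y + y * y - 2 * x - 2 * y) = 0) by lra.
    apply Rmult_integral in E as [E|E]; [lra|nra].
  - assert (L : forall z, 0 < z -> z * (z * (z * (z - 1) - z) - z * (z - 1)) = rho ->
      (* Just below the root [(3 + sqrt 5) / 2] of [z^2 - 3 z + 1], the factor that must be
         positive. *)
      26 / 10 < z).
    { intros z Hz Ez. apply Rnot_le_lt; intros X.
      assert (Ez' : (z * z) * (z * z - 3 * z + 1) = rho) by lra.
      destruct (Rle_dec z 1) as [z1|z1].
      - assert (z * z <= 1) by nra. assert (z * z - 3 * z + 1 <= 1) by nra. nra.
      - assert (z * z - 3 * z + 1 <= 0) by nra. nra. }
    apply L in Ex as x2; [|exact Hx]. apply L in Ey as y2; [|exact Hy].
    assert (E : (x - y) * ((x + y) * (x * x + y * y)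
      - 3 * (x * x + x * y + y * y) + (x + y)) = 0) by lra.
    apply Rmult_integral in E as [E|E]; [lra|].
    assert (52 / 10 * (x * x + y * y) <= (x + y) * (x * x + y * y)) by nra.
    nra.
Qed.

(** * Running the algorithm *)

Lemma addr_INR (k : nat) : addr (INR k) = k.
Proof.
  unfold addr. rewrite Int_part_INR, Nat2Z.id. reflexivity.
Qed.

Lemma addr_0 : addr 0 = 0%nat.
Proof. exact (addr_INR 0). Qed.

Lemma upd_same (s : state) (x : string) (k : nat) (v : R) : upd s x k v x k = v.
Proof. unfold upd. rewrite String.eqb_refl, Nat.eqb_refl. reflexivity. Qed.

Lemma upd_other_name (s : state) (x y : string) (k j : nat) (v : R) :
  x <> y -> upd s x k v y j = s y j.
Proof. intros H. unfold upd. apply String.eqb_neq in H. rewrite H. reflexivity. Qed.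

Lemma upd_other_cell (s : state) (x : string) (k j : nat) (v : R) :
  k <> j -> upd s x k v x j = s x j.
Proof.
  intros H. unfold upd. apply Nat.eqb_neq in H.
  rewrite String.eqb_refl, H. reflexivity.
Qed.

Lemma exec_store (x : string) (i e : expr) (s : state) (k : nat) (v : R) :
  eval s i = INR k -> eval s e = v ->
  exec (Store x i e) s (S (ecost i + ecost e)) (upd s x k v).
Proof.
  intros Hi He. assert (H := ExStore x i e s).
  rewrite Hi, He, addr_INR in H. exact H.
Qed.

Lemma exec_assign (x : string) (e : expr) (s : state) (v : R) :
  eval s e = v ->
  exec (Store x (Cst 0) e) s (S (S (ecost e))) (upd s x 0 v).
Proof. intros He. exact (exec_store x (Cst 0) e s 0 v eq_refl He). Qed.

(** [unop_val] stays folded, so that evaluated roots match the lemmas on radicals. *)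
Ltac ev :=
  cbn [eval binop_val holds]; rewrite ?addr_0;
  cbn [upd String.eqb Ascii.eqb Bool.eqb andb Nat.eqb].

Ltac step v := eapply ExSeq; [eapply (exec_assign _ _ _ v); ev|].

Definition recurrence_loop : cmd :=
  (While ($"i" <=? $"n")
     (Store "a" ($"i" + 1)
        ($"a0" * (Get "a" ($"i") - Get "a" ($"i" - 1))) ;;
      "i" <~ $"i" + 1))%cmd.

Definition output_loop : cmd :=
  (While ($"i" <? $"n")
     (Store "f" ($"i") (Get "a" ($"i" + 1) * $"lambda") ;;
      "i" <~ $"i" + 1))%cmd.

(** Induction on the number [m] of iterations left. Cell [k] holds [a_(k-1)], which is
    [qpol (k+1) a]. The 5 steps pay for the final failing test, and 30 cover one iteration. *)
Lemma recurrence_loop_spec (a : R) (n m i : nat) (s : state) :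
  (i + m = S n)%nat -> (1 <= i)%nat ->
  s "i" 0%nat = INR i -> s "n" 0%nat = INR n -> s "a0" 0%nat = a ->
  (forall k, (k <= i)%nat -> s "a" k = qpol (S k) a) ->
  exists t s', exec recurrence_loop s t s' /\ (t <= 5 + 30 * m)%nat /\
    (forall k, (k <= S n)%nat -> s' "a" k = qpol (S k) a) /\
    (forall y j, y <> "a" -> y <> "i" -> s' y j = s y j).
Proof.
  revert i s; induction m as [|m IH]; intros i s Him Hi Vi Vn Va Vc.
  - do 2 eexists. split; [apply ExWhileFalse|].
    { ev. rewrite Vi, Vn. apply Rlt_not_le, lt_INR; lia. }
    cbn [tcost ecost]. split; [lia|]. split; [|reflexivity].
    intros k Hk; apply Vc; lia.
  - destruct i as [|i]; [lia|].
    set (v := a * (qpol (S (S i)) a - qpol (S i) a)).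
    set (s1 := upd s "a" (S (S i)) v).
    set (s2 := upd s1 "i" 0 (INR (S (S i)))).
    assert (E1 : exec (Store "a" ($"i" + 1)
        ($"a0" * (Get "a" ($"i") - Get "a" ($"i" - 1))))%expr s
        (S (ecost ($"i" + 1)%expr +
          ecost ($"a0" * (Get "a" ($"i") - Get "a" ($"i" - 1)))%expr)) s1).
    { apply exec_store; ev.
      - rewrite Vi, <- S_INR. reflexivity.
      - rewrite Vi, Va.
        replace (INR (S i) - 1) with (INR i) by (rewrite S_INR; ring).
        rewrite !addr_INR, !Vc by lia. reflexivity. }
    assert (E2 : exec ("i" <~ $"i" + 1)%cmd s1
      (S (S (ecost ($"i" + 1)%expr))) s2).
    { apply exec_assign. ev. unfold s1. ev. rewrite Vi, <- S_INR. reflexivity. }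
    destruct (IH (S (S i)) s2) as (t & s' & H1 & H2 & H3 & H4); try lia.
    { reflexivity. }
    { exact Vn. }
    { exact Va. }
    { intros k Hk. unfold s2, s1. rewrite upd_other_name by easy.
      destruct (Nat.eq_dec k (S (S i))) as [->|].
      - rewrite upd_same. reflexivity.
      - rewrite upd_other_cell by lia. apply Vc; lia. }
    do 2 eexists. split; [|split; [|split]].
    + eapply ExWhileTrue; [|eapply ExSeq; [exact E1|exact E2]|exact H1].
      ev. rewrite Vi, Vn. apply le_INR; lia.
    + cbn [tcost ecost]. lia.
    + exact H3.
    + intros y j Hy1 Hy2. rewrite H4 by assumption.
      unfold s2, s1. rewrite !upd_other_name by congruence. reflexivity.
Qed.

Lemma output_loop_spec (a lam : R) (n m i : nat) (s : state) :
  (i + m = n)%nat ->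
  s "i" 0%nat = INR i -> s "n" 0%nat = INR n -> s "lambda" 0%nat = lam ->
  (forall k, (k <= S n)%nat -> s "a" k = qpol (S k) a) ->
  (forall k, (k < i)%nat -> s "f" k = lam * pol k a) ->
  exists t s', exec output_loop s t s' /\ (t <= 5 + 30 * m)%nat /\
    (forall k, (k < n)%nat -> s' "f" k = lam * pol k a) /\
    (forall y j, y <> "f" -> y <> "i" -> s' y j = s y j).
Proof.
  revert i s; induction m as [|m IH]; intros i s Him Vi Vn Vl Va Vf.
  - do 2 eexists. split; [apply ExWhileFalse|].
    { ev. rewrite Vi, Vn. apply Rle_not_lt, le_INR; lia. }
    cbn [tcost ecost]. split; [lia|]. split; [|reflexivity].
    intros k Hk; apply Vf; lia.
  - set (s1 := upd s "f" i (lam * pol i a)).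
    set (s2 := upd s1 "i" 0 (INR (S i))).
    assert (E1 : exec (Store "f" ($"i") (Get "a" ($"i" + 1) * $"lambda"))%expr s
        (S (ecost ($"i")%expr + ecost (Get "a" ($"i" + 1) * $"lambda")%expr)) s1).
    { apply exec_store; ev.
      - exact Vi.
      - rewrite Vi, Vl, <- S_INR, addr_INR, Va by lia. rewrite pol_qpol. ring. }
    assert (E2 : exec ("i" <~ $"i" + 1)%cmd s1
      (S (S (ecost ($"i" + 1)%expr))) s2).
    { apply exec_assign. ev. unfold s1. ev. rewrite Vi, <- S_INR. reflexivity. }
    destruct (IH (S i) s2) as (t & s' & H1 & H2 & H3 & H4); try lia;
      try assumption.
    { reflexivity. }
    { intros k Hk. unfold s2, s1. rewrite upd_other_name by easy.
      destruct (Nat.eq_dec k i) as [->|].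
      - rewrite upd_same. reflexivity.
      - rewrite upd_other_cell by lia. apply Vf; lia. }
    do 2 eexists. split; [|split; [|split]].
    + eapply ExWhileTrue; [|eapply ExSeq; [exact E1|exact E2]|exact H1].
      ev. rewrite Vi, Vn. apply lt_INR; lia.
    + cbn [tcost ecost]. lia.
    + exact H3.
    + intros y j Hy1 Hy2. rewrite H4 by assumption.
      unfold s2, s1. rewrite !upd_other_name by congruence. reflexivity.
Qed.

(** [algorithm] is convertible to its preparation followed by [compute_a0] and this tail. *)
Definition write_output : cmd :=
  (Store "a" 1 ($"a0") ;;
   "i" <~ 1 ;;
   recurrence_loop ;;
   "i" <~ 0 ;;
   output_loop ;;
   Store "f" ($"n") ($"Lambda") ;;
   "value" <~ 2 * $"a0" + 1)%cmd.

Lemma write_output_spec (lam Lam a : R) (n : nat) (s : state) :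
  s "lambda" 0%nat = lam -> s "Lambda" 0%nat = Lam ->
  s "n" 0%nat = INR n -> s "a0" 0%nat = a -> s "a" 0%nat = 1 ->
  exists t s', exec write_output s t s' /\ (t <= 100 + 60 * n)%nat /\
    output_n s' = INR n /\ has_entries lam Lam a n (output_strategy s').
Proof.
  intros Vl VL Vn Va V1.
  set (s1 := upd s "a" 1 a).
  set (s2 := upd s1 "i" 0 1).
  destruct (recurrence_loop_spec a n n 1 s2) as (t3 & s3 & E3 & T3 & A3 & F3);
    try lia; try reflexivity; try assumption.
  (* Cells 0 and 1 hold [a_(-1) = 1] and [a_0 = a = qpol 2 a]. *)
  { intros [|[|k]] Hk; [exact V1| |lia].
    unfold s2, s1. rewrite upd_other_name, upd_same by easy. simpl. ring. }
  set (s4 := upd s3 "i" 0 0).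
  destruct (output_loop_spec a lam n n 0 s4) as (t5 & s5 & E5 & T5 & A5 & F5);
    try lia; try reflexivity.
  { unfold s4. ev. rewrite F3 by easy. exact Vn. }
  { unfold s4. ev. rewrite F3 by easy. exact Vl. }
  { exact A3. }
  assert (V5 : forall y j, y <> "f" -> y <> "i" -> y <> "a" -> s5 y j = s y j).
  { intros y j H1 H2 H3. rewrite F5 by assumption.
    unfold s4. rewrite upd_other_name by congruence. rewrite F3 by assumption.
    unfold s2, s1. rewrite !upd_other_name by congruence. reflexivity. }
  set (s6 := upd s5 "f" n Lam).
  do 2 eexists. split; [|split; [|split]].
  - eapply ExSeq; [apply (exec_store _ _ _ _ 1 a); [reflexivity|ev; exact Va]|].
    step 1; [reflexivity|].
    eapply ExSeq; [exact E3|].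
    step 0; [reflexivity|].
    eapply ExSeq; [exact E5|].
    eapply ExSeq; [apply (exec_store _ _ _ _ n Lam); ev; rewrite V5 by easy; assumption|].
    apply (exec_assign _ _ _ (2 * a + 1)). ev.
    rewrite V5 by easy. rewrite Va. reflexivity.
  - cbn [ecost]. lia.
  - unfold output_n. ev. rewrite V5 by easy. exact Vn.
  - assert (W : forall i, output_strategy
      (upd (upd s5 "f" n Lam) "value" 0 (2 * a + 1)) i = s6 "f" (Nat.min i n)).
    { intros i. unfold output_strategy, output_n.
      rewrite !(upd_other_name _ "value"), (upd_other_name _ _ "n") by easy.
      rewrite V5, Vn, addr_INR by easy. reflexivity. }
    split; intros i Hi; rewrite W.
    + rewrite Nat.min_l by lia. unfold s6. rewrite upd_other_cell by lia.
      apply A5; exact Hi.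
    + rewrite Nat.min_r by lia. apply upd_same.
Qed.

Lemma solve_by_radicals_spec (rho : R) (n : nat) (s : state) :
  (n <= 3)%nat -> threshold n <= rho ->
  s "n" 0%nat = INR n -> s "rho" 0%nat = rho ->
  exists t s', exec solve_by_radicals s t s' /\ (t <= 200)%nat /\
    0 < s' "a0" 0%nat /\ pol n (s' "a0" 0%nat) = rho /\
    s' "n" 0%nat = INR n /\ s' "lambda" 0%nat = s "lambda" 0%nat /\
    s' "Lambda" 0%nat = s "Lambda" 0%nat /\ s' "a" 0%nat = s "a" 0%nat.
Proof.
  intros Hn Ht Vn Vr. unfold solve_by_radicals.
  assert (T := threshold_lower n).
  assert (T1 : 1 <= 2 ^ n) by (apply pow_R1_Rle; lra).
  destruct n as [|[|[|[|n]]]]; [| | | |lia]; simpl in Vn, T.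
  - do 2 eexists. split; [|split; [|split; [|split]]].
    + apply ExIfTrue; [ev; lra|]. apply (exec_assign _ _ _ rho). ev. exact Vr.
    + cbn [ecost tcost]. lia.
    + ev. lra.
    + ev. reflexivity.
    + ev. auto.
  - destruct (radical_1 rho) as [R1 R2]; [lra|].
    set (a0 := (1 + unop_val (URoot 2) (1 + 4 * rho)) / 2) in *.
    do 2 eexists. split; [|split; [|split; [|split]]].
    + apply ExIfFalse; [ev; lra|]. apply ExIfTrue; [ev; lra|].
      apply (exec_assign _ _ _ a0). ev. rewrite Vr. reflexivity.
    + cbn [ecost tcost]. lia.
    + ev. exact R1.
    + ev. exact R2.
    + ev. auto.
  - remember ((rho + 16 / 27) / 2) as q eqn:Hq.
    remember (unop_val (URoot 2) (q * q - 64 / 729)) as d eqn:Hd.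
    destruct (radical_2 rho q d) as [R1 R2]; [lra|assumption|assumption|].
    set (a0 := 2 / 3 + unop_val (URoot 3) (q + d) + unop_val (URoot 3) (q - d)) in *.
    do 2 eexists. split; [|split; [|split; [|split]]].
    + apply ExIfFalse; [ev; lra|]. apply ExIfFalse; [ev; lra|].
      apply ExIfTrue; [ev; lra|].
      step q; [rewrite Vr; symmetry; exact Hq|].
      step d; [symmetry; exact Hd|].
      apply (exec_assign _ _ _ a0). ev. reflexivity.
    + cbn [ecost tcost]. lia.
    + ev. exact R1.
    + ev. exact R2.
    + ev. auto.
  - remember ((rho - 1 / 12) / 3) as P eqn:HP.
    remember ((19 * rho / 24 - 1 / 108) / 2) as q eqn:Hq.
    remember (unop_val (URoot 2) (q * q + P * P * P)) as d eqn:Hd.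
    remember (1 / 6 + unop_val (URoot 3) (d - q) - unop_val (URoot 3) (d + q))
      as m eqn:Hm.
    remember (unop_val (URoot 2) (5 / 4 + 2 * m)) as r eqn:Hs.
    remember (3 / 2 + r) as b eqn:Hb.
    remember (m + 3 * m / (2 * r)) as c eqn:Hc.
    destruct (radical_3 rho P q d m r b c) as [R1 R2]; [lra|assumption..|].
    set (a0 := (b + unop_val (URoot 2) (b * b - 4 * c)) / 2) in *.
    do 2 eexists. split; [|split; [|split; [|split]]].
    + apply ExIfFalse; [ev; lra|]. apply ExIfFalse; [ev; lra|].
      apply ExIfFalse; [ev; lra|].
      step P; [rewrite Vr; symmetry; exact HP|].
      step q; [rewrite Vr; symmetry; exact Hq|].
      step d; [symmetry; exact Hd|].
      step m; [symmetry; exact Hm|].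
      step r; [symmetry; exact Hs|].
      step b; [symmetry; exact Hb|].
      step c; [symmetry; exact Hc|].
      apply (exec_assign _ _ _ a0). ev. reflexivity.
    + cbn [ecost tcost]. lia.
    + ev. exact R1.
    + ev. exact R2.
    + ev. auto.
Qed.

(** * Complete runs and their cost *)

Definition compute_a0 (Q : cmd) : cmd :=
  (If ($"n" <=? 3)
     solve_by_radicals
   (If (7 * $"eps" ^ (-1 / 3)%R - 4 <=? $"n")
     ("a0" <~ $"hi")
     (Call "a0" Q [("n", $"n"); ("rho", $"rho"); ("eps", $"eps");
                   ("lo", $"lo"); ("hi", $"hi")]%expr)))%cmd.

Definition prepared (lam Lam eps : R) (n : nat) (s : state) : Prop :=
  s "lambda" 0%nat = lam /\ s "Lambda" 0%nat = Lam /\ s "eps" 0%nat = eps /\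
  s "rho" 0%nat = Lam / lam /\ s "n" 0%nat = INR n /\ s "a" 0%nat = 1 /\
  s "lo" 0%nat = alpha (S n) /\ s "hi" 0%nat = alpha (S (S n)).

(** With [N = floor (log2 rho)], a decrement is correct because [threshold (N-1) < 2^N <= rho], and
    keeping [N] is correct because [rho < 2^(N+1) <= threshold (N+1)]. The conclusion extends any
    run of the remaining program, so that all branches for [a0] share it. *)
Lemma algorithm_prepare (Q : cmd) (lam Lam eps : R) :
  0 < lam <= Lam ->
  exists (n : nat) (s : state),
    threshold n <= Lam / lam < threshold (S n) /\
    prepared lam Lam eps n s /\
    forall t1 s1, exec (Seq (compute_a0 Q) write_output) s t1 s1 ->
      exists t, exec (algorithm Q) (input lam Lam eps) t s1 /\
        (t1 <= t <= 150 + t1)%nat.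
Proof.
  intros Hl. set (rho := Lam / lam).
  assert (Hr : 1 <= rho).
  { unfold rho. apply Rmult_le_reg_r with lam; [lra|].
    unfold Rdiv. rewrite Rmult_assoc, Rinv_l; lra. }
  destruct (floor_log2 rho Hr) as (N & EN & HN1 & HN2).
  set (g := 2 * cos (PI / (INR N + 3))).
  set (s4 := upd (upd (upd (upd (input lam Lam eps) "rho" 0 rho) "n" 0 (INR N))
    "gamma" 0 g) "a" 0 1).
  assert (Hif : exists n t s5,
    exec (If (1 <? $"gamma")
     (If (lnE ($"rho") / lnE ($"gamma") <? $"n" + 1)
       ("n" <~ $"n" - 1)
       Skip)
     Skip)%cmd s4 t s5 /\ (t <= 40)%nat /\
    threshold n <= rho < threshold (S n) /\
    s5 "lambda" 0%nat = lam /\ s5 "Lambda" 0%nat = Lam /\ s5 "eps" 0%nat = eps /\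
    s5 "rho" 0%nat = rho /\ s5 "n" 0%nat = INR n /\ s5 "a" 0%nat = 1).
  { assert (TL := threshold_lower (S N)).
    destruct N as [|N].
    (* For [N = 0] the base is 1 and the guard skips the test; [threshold 0 = 1] makes 0 the right
       index. *)
    - exists 0%nat. do 2 eexists. split; [|split; [|split]].
      + apply ExIfFalse; [|apply ExSkip]. ev. unfold s4, g. ev.
        replace (INR 0 + 3) with 3 by (simpl; ring). rewrite cos_PI3. lra.
      + cbn [tcost ecost]. lia.
      + rewrite threshold_0. lra.
      + repeat split.
    - assert (G1 : 1 < g) by (apply gamma_gt_1; lia).
      assert (HL := log_lt_threshold rho (S N) ltac:(lra) G1). fold g in HL.
      destruct (Rlt_dec rho (threshold (S N))) as [L|L].
      + exists N. do 2 eexists. split; [|split; [|split]].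
        * apply ExIfTrue; [ev; exact G1|]. apply ExIfTrue.
          { ev. unfold s4. ev. cbn [unop_val]. apply HL, L. }
          apply (exec_assign _ _ _ (INR N)). ev. unfold s4. ev.
          rewrite S_INR. ring.
        * cbn [tcost ecost]. lia.
        * split; [|exact L]. assert (TU := threshold_upper N). lra.
        * repeat split.
      + exists (S N). do 2 eexists. split; [|split; [|split]].
        * apply ExIfTrue; [ev; exact G1|]. apply ExIfFalse; [|apply ExSkip].
          ev. unfold s4. ev. cbn [unop_val]. intros X; apply L, HL, X.
        * cbn [tcost ecost]. lia.
        * split; lra.
        * repeat split. }
  destruct Hif as (n & t5 & s5 & E5 & T5 & Hn & Vl & VL & Ve & Vr & Vn & V1).
  assert (A1 : 4 * cos (PI / (INR n + 3)) * cos (PI / (INR n + 3)) = alpha (S n)).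
  { unfold alpha. replace (INR (S n) + 2) with (INR n + 3) by (rewrite S_INR; ring).
    reflexivity. }
  assert (A2 : 4 * cos (PI / (INR n + 4)) * cos (PI / (INR n + 4)) = alpha (S (S n))).
  { unfold alpha.
    replace (INR (S (S n)) + 2) with (INR n + 4) by (rewrite !S_INR; ring).
    reflexivity. }
  exists n, (upd (upd s5 "lo" 0 (alpha (S n))) "hi" 0 (alpha (S (S n)))).
  split; [exact Hn|]. split.
  { unfold prepared. ev. auto 10. }
  intros t1 s1 E. eexists. split.
  - step rho; [reflexivity|].
    step (INR N); [exact EN|].
    step g; [reflexivity|].
    eapply ExSeq; [apply (exec_assign _ _ _ 1); reflexivity|].
    eapply ExSeq; [exact E5|].
    step (alpha (S n)); [rewrite Vn; exact A1|].
    step (alpha (S (S n))); [rewrite Vn; exact A2|].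
    exact E.
  - cbn [ecost]. lia.
Qed.

Lemma run_radicals (Q : cmd) (lam Lam eps : R) (n : nat) (s : state) :
  0 < lam <= Lam -> (n <= 3)%nat ->
  threshold n <= Lam / lam < threshold (S n) ->
  prepared lam Lam eps n s ->
  exists t s', exec (Seq (compute_a0 Q) write_output) s t s' /\
    (t <= 310 + 60 * n)%nat /\ optimal lam Lam (output_strategy s').
Proof.
  intros Hl Hn Hr (Vl & VL & _ & Vr & Vn & V1 & _).
  destruct (solve_by_radicals_spec (Lam / lam) n s) as
    (t1 & s1 & E1 & T1 & P1 & R1 & W1 & W2 & W3 & W4); try assumption; [lra|].
  destruct (write_output_spec lam Lam (s1 "a0" 0%nat) n s1) as
    (t2 & s2 & E2 & T2 & _ & F2); try congruence.
  do 2 eexists. split; [|split].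
  - eapply ExSeq; [|exact E2]. apply ExIfTrue; [|exact E1].
    ev. rewrite Vn. apply le_INR in Hn. simpl in Hn. lra.
  - cbn [tcost ecost]. lia.
  - destruct (pol_root_exists n (Lam / lam) Hr) as (a & Ha & Ea).
    assert (Ba := in_bracket_alpha n a Ha).
    (* The radicals only provide a positive solution; uniqueness identifies it with the root in the
       bracket, to which the lower bound applies. *)
    assert (E : s1 "a0" 0%nat = a).
    { apply (pol_root_unique n (Lam / lam)); try assumption; [lra|].
      exact (proj1 Ba). }
    rewrite E in F2. apply entries_optimal with a n; assumption.
Qed.

(** The call executes [Q] in exactly the memory [root_input], so its time enters the total
    additively, and everything else is linear in [n]. *)
Lemma run_numeric (Q : cmd) (lam Lam eps : R) (n : nat) (s : state) :
  root_finder Q -> 0 < lam <= Lam -> 0 < eps -> (4 <= n)%nat ->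
  threshold n <= Lam / lam < threshold (S n) ->
  prepared lam Lam eps n s ->
  exists t s', exec (Seq (compute_a0 Q) write_output) s t s' /\
    output_n s' = INR n /\ strategy (output_strategy s') /\
    (exists f_opt, optimal lam Lam f_opt /\
      Rbar_le (CR lam Lam (output_strategy s'))
        (Rbar_plus (CR lam Lam f_opt) (Finite eps))) /\
    (7 * Rpower eps (-1 / 3) - 4 <= INR n -> (t <= 150 + 60 * n)%nat) /\
    (INR n < 7 * Rpower eps (-1 / 3) - 4 ->
      exists tQ sQ,
        exec Q (root_input n (Lam / lam) eps (alpha (S n)) (alpha (S (S n)))) tQ sQ /\
        (tQ <= t <= tQ + 150 + 60 * n)%nat).
Proof.
  intros HQ Hl He Hn Hr (Vl & VL & Ve & Vr & Vn & V1 & Vlo & Vhi).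
  assert (Hn4 : 4 <= INR n) by (apply le_INR in Hn; simpl in Hn; lra).
  assert (Hn3 : ~ holds s ($"n" <=? 3)%cmd) by (ev; lra).
  assert (Hp : rpow eps (-1 / 3) = Rpower eps (-1 / 3)).
  { unfold rpow. destruct (Rlt_dec 0 eps); [reflexivity|lra]. }
  assert (Hal := alpha_increasing n).
  destruct (Rle_dec (7 * Rpower eps (-1 / 3) - 4) (INR n)) as [Hlarge|Hsmall].
  - set (s1 := upd s "a0" 0 (alpha (S (S n)))).
    destruct (write_output_spec lam Lam (alpha (S (S n))) n s1) as
      (t2 & s2 & E2 & T2 & N2 & F2); try assumption; [reflexivity|].
    do 2 eexists. split; [|split; [exact N2|split; [|split; [|split]]]].
    + eapply ExSeq; [|exact E2]. apply ExIfFalse; [exact Hn3|].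
      apply ExIfTrue; [|apply exec_assign; ev; exact Vhi].
      ev. rewrite Ve, Vn, Hp. exact Hlarge.
    + apply has_entries_strategy with lam Lam (alpha (S (S n))) n; try assumption.
      apply in_bracket_alpha; lra.
    + apply entries_near_optimal with (alpha (S (S n))) n; try assumption; [lra|].
      right; split; [reflexivity|exact Hlarge].
    + intros _. cbn [tcost ecost]. lia.
    + lra.
  - apply Rnot_le_lt in Hsmall.
    destruct (HQ n (Lam / lam) eps (alpha (S n)) (alpha (S (S n))))
      as (tQ & sQ & EQ & BQ & AQ); try assumption.
    { replace (n + 1)%nat with (S n) by lia. apply largest_root_alpha; lia. }
    { replace (n + 2)%nat with (S (S n)) by lia. apply largest_root_alpha; lia. }
    { rewrite pol_alpha_lower, pol_alpha_upper. exact Hr. }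
    set (a := sQ "result" 0%nat) in *.
    set (s1 := upd s "a0" 0 a).
    destruct (write_output_spec lam Lam a n s1) as
      (t2 & s2 & E2 & T2 & N2 & F2); try assumption; [reflexivity|].
    do 2 eexists. split; [|split; [exact N2|split; [|split; [|split]]]].
    + eapply ExSeq; [|exact E2]. apply ExIfFalse; [exact Hn3|].
      apply ExIfFalse; [ev; rewrite Ve, Vn, Hp; lra|].
      apply ExCall. unfold eval_args. cbn [map fst snd]. ev.
      rewrite Vn, Vr, Ve, Vlo, Vhi. exact EQ.
    + apply has_entries_strategy with lam Lam a n; try assumption.
      apply in_bracket_alpha; lra.
    + apply entries_near_optimal with a n; try assumption.
      left; exact AQ.
    + lra.
    + intros _. exists tQ, sQ. split; [exact EQ|].
      cbn [tcost ecost args_cost fold_right snd]. lia.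
Qed.

Lemma INR_affine_bound (t k n : nat) :
  (t <= k + 1000 * n)%nat -> INR t <= INR k + 1000 * INR n.
Proof.
  intros H. apply le_INR in H.
  rewrite plus_INR, mult_INR, (INR_IZR_INZ 1000) in H. exact H.
Qed.

(** Since [2^n <= rho < 2^(n+2)] and [1/2 < ln 2 < 1], the index and [ln rho] are within constant
    factors of each other. *)
Lemma threshold_log_bounds (n : nat) (rho : R) :
  (4 <= n)%nat -> threshold n <= rho < threshold (S n) ->
  INR n <= 1000 * ln rho /\ ln rho <= 1000 * INR n.
Proof.
  intros Hn Hr. apply le_INR in Hn. simpl in Hn.
  assert (L := threshold_lower n). assert (U := threshold_upper (S n)).
  assert (P : 0 < 2 ^ n) by (apply pow_lt; lra).
  assert (E : forall k, ln (2 ^ k) = INR k * ln 2).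
  { intros k. rewrite <- Rpower_pow by lra. apply ln_exp. }
  assert (H1 : ln (2 ^ n) <= ln rho) by (apply ln_le; lra).
  assert (H2 : ln rho <= ln (2 ^ S (S n))) by (apply ln_le; lra).
  rewrite E in H1, H2. rewrite !S_INR in H2.
  assert (L2 := ln_lt_2).
  assert (U2 : ln 2 < 1).
  { rewrite <- (ln_exp 1). apply ln_increasing; [lra|].
    assert (X := exp_ineq1 1 ltac:(lra)). lra. }
  split; nra.
Qed.

Theorem theorem9 :
  exists C : R,
    (* (a) *)
    (forall (Q : cmd) (lam Lam eps : R),
      0 < lam <= Lam -> 0 < eps ->
      Lam / lam < 32 * cos (PI / 7) ^ 5 ->
      exists (t : nat) (s : state),
        exec (algorithm Q) (input lam Lam eps) t s /\
        optimal lam Lam (output_strategy s) /\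
        INR t <= C) /\
    (* (b) *)
    (forall (Q : cmd) (lam Lam eps : R),
      root_finder Q ->
      0 < lam <= Lam -> 0 < eps ->
      32 * cos (PI / 7) ^ 5 <= Lam / lam ->
      exists (t : nat) (s : state) (n : nat),
        exec (algorithm Q) (input lam Lam eps) t s /\
        output_n s = INR n /\
        strategy (output_strategy s) /\
        (exists f_opt : nat -> R,
          optimal lam Lam f_opt /\
          Rbar_le (CR lam Lam (output_strategy s))
                  (Rbar_plus (CR lam Lam f_opt) (Finite eps))) /\
        (7 * Rpower eps (-1 / 3) - 4 <= INR n ->
          INR t <= C * INR n /\
          INR n <= C * ln (Lam / lam) /\ ln (Lam / lam) <= C * INR n) /\
        (INR n < 7 * Rpower eps (-1 / 3) - 4 ->
          exists (lo hi : R) (tQ : nat) (sQ : state),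
            largest_root (n + 1) lo /\ largest_root (n + 2) hi /\
            pol n lo <= Lam / lam < pol n hi /\
            exec Q (root_input n (Lam / lam) eps lo hi) tQ sQ /\
            (tQ <= t)%nat /\ INR t <= INR tQ + C * INR n)).
Proof.
  (* One constant serves every bound: the exact case takes at most 640 steps, and otherwise the
     overhead is at most [300 + 60 n] with [n >= 4]. *)
  exists 1000. split.
  - intros Q lam Lam eps Hl He Hr. rewrite <- threshold_4 in Hr.
    destruct (algorithm_prepare Q lam Lam eps Hl) as (n & s & Hn & Hs & Hrun).
    assert (n3 : (n <= 3)%nat).
    { apply Nat.nlt_ge; intros X.
      assert (Y := threshold_increasing 4 n ltac:(lia)). lra. }
    destruct (run_radicals Q lam Lam eps n s Hl n3 Hn Hs) as (t1 & s1 & E1 & T1 & O1).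
    destruct (Hrun t1 s1 E1) as (t & E & T).
    exists t, s1. split; [exact E|]. split; [exact O1|].
    replace 1000 with (0 + 1000 * INR 1) by (simpl; ring).
    apply (INR_affine_bound t 0 1); lia.
  - intros Q lam Lam eps HQ Hl He Hr. rewrite <- threshold_4 in Hr.
    destruct (algorithm_prepare Q lam Lam eps Hl) as (n & s & Hn & Hs & Hrun).
    assert (n4 : (4 <= n)%nat).
    { apply Nat.nlt_ge; intros X.
      assert (Y := threshold_increasing (S n) 4 ltac:(lia)). lra. }
    destruct (run_numeric Q lam Lam eps n s HQ Hl He n4 Hn Hs)
      as (t1 & s1 & E1 & N1 & S1 & O1 & T1 & R1).
    destruct (Hrun t1 s1 E1) as (t & E & T).
    exists t, s1, n. split; [exact E|]. split; [exact N1|].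
    split; [exact S1|]. split; [exact O1|]. split.
    + intros Hlarge. specialize (T1 Hlarge).
      split; [|apply (threshold_log_bounds n); [lia|exact Hn]].
      rewrite <- (Rplus_0_l (1000 * INR n)). apply (INR_affine_bound t 0); lia.
    + intros Hsmall. destruct (R1 Hsmall) as (tQ & sQ & EQ & TQ).
      exists (alpha (S n)), (alpha (S (S n))), tQ, sQ.
      replace (n + 1)%nat with (S n) by lia. replace (n + 2)%nat with (S (S n)) by lia.
      split; [apply largest_root_alpha; lia|].
      split; [apply largest_root_alpha; lia|].
      rewrite pol_alpha_lower, pol_alpha_upper.
      split; [exact Hn|]. split; [exact EQ|]. split; [lia|].
      apply INR_affine_bound; lia.
Qed.
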